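(* For any dimension $n\ge 1$ and any smooth $f\colon\mathbb{R}^n\to\mathbb{R}$ with $\int f\, d\gamma_n =0$, the following inequalities hold: $$ \log \int e^f d\gamma_n \leq 8 \int_{\mathbb{R}^n} \frac{e^{\frac{|\nabla f|^2}{2}}}{ \sqrt{1+ \frac{|\nabla f|^2}{2}}}\, d\gamma_n \leq 14 \int_{\mathbb{R}^n} \frac{e^{\frac{|\nabla f|^2}{2}}}{1+ |\nabla f|}\, d\gamma_n. $$
   Context: $\gamma_n$ is the standard Gaussian measure on $\mathbb{R}^n$, with density $(2\pi)^{-n/2}e^{-|x|^2/2}$; $|\cdot|$ is the Euclidean norm. *)

(* Defs.v *)
From HB Require Import structures.
From mathcomp Require Import all_boot all_order all_algebra.
From mathcomp Require Import all_classical all_reals all_analysis.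
From mathcomp Require Import measurable_realfun.

Set Implicit Arguments.
Unset Strict Implicit.
Unset Printing Implicit Defensive.

Import Order.TTheory GRing.Theory Num.Theory.
Import numFieldNormedType.Exports.

Local Open Scope classical_set_scope.
Local Open Scope ring_scope.

Definition borel_rV (R : realType) (n : nat) :=
  g_sigma_algebraType (@open 'rV[R]_n).

Section cube.
Context {R : realType} {n : nat}.
Implicit Types (v : 'rV[R]_n) (U : set 'rV[R]_n).

Definition cube v (r : R) : set 'rV[R]_n :=
  [set w | forall i, `|v ord0 i - w ord0 i| < r].

Lemma cubeE v r : 0 < r -> cube v r = ball v r.
Proof.
move=> r0; apply/seteqP; split=> w /=.
  by move=> vw; split => // i j; rewrite (ord1 i); exact: vw.
by case=> _ vw i; exact: vw.
Qed.

Lemma open_rV_measurable U :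
  open U -> measurable (U : set (borel_rV R n)).
Proof. by move=> oU; exact: sub_sigma_algebra. Qed.

Lemma measurable_cube v r :
  0 < r -> measurable (cube v r : set (borel_rV R n)).
Proof. by move=> r0; rewrite cubeE//; apply: open_rV_measurable; exact: ball_open. Qed.

Lemma open_rV_bigcup U : open U -> U =
  \bigcup_(p in [set p : 'rV[rat]_n * nat |
    cube (map_mx ratr p.1) p.2.+1%:R^-1 `<=` U])
    cube (map_mx ratr p.1) p.2.+1%:R^-1.
Proof.
move=> oU; apply/seteqP; split=> [v Uv|v [p]]; last exact.
have /nbhs_ballP[e /= e0 veU] := open_nbhs_nbhs (conj oU Uv).
have e20 : 0 < e / 2 by rewrite divr_gt0.
have [k] := ltr_add_invr e20.
rewrite add0r => ke.
have k0 : (0 : R) < k.+1%:R^-1 by rewrite invr_gt0.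
have /fin_all_exists[q qv] : forall i : 'I_n, exists q : rat,
    `|ratr q - v ord0 i| < k.+1%:R^-1.
  move=> i.
  have [|q] := @rat_in_itvoo R (v ord0 i - k.+1%:R^-1) (v ord0 i + k.+1%:R^-1).
    by rewrite ltrBlDr -addrA ltrDl addr_gt0.
  by rewrite in_itv/= => qi; exists q; rewrite ltr_distl.
exists (\row_i q i, k) => /=; last by move=> i; rewrite !mxE.
move=> w vw; apply: veU; rewrite -cubeE// => i.
rewrite (splitr e) (le_lt_trans (ler_distD (ratr (q i)) _ _))// ltrD//.
  by rewrite distrC (lt_trans (qv i)).
by have := vw i; rewrite !mxE => /lt_trans; exact.
Qed.

End cube.

Section cons_rV.
Context {R : realType} {n : nat}.

Definition cons_rV (p : R * borel_rV R n) : borel_rV R n.+1 :=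
  row_mx (p.1%:M : 'rV[R]_1) (p.2 : 'rV[R]_n).

Definition uncons_rV (v : borel_rV R n.+1) : R * borel_rV R n :=
  ((v : 'rV[R]_n.+1) ord0 ord0, rsubmx (v : 'rV[R]_(1 + n))).

Lemma cons_rVK : cancel cons_rV uncons_rV.
Proof.
move=> [x v]; rewrite /uncons_rV /cons_rV/= row_mxKr; congr pair.
have -> : ord0 = lshift n (ord0 : 'I_1) :> 'I_(1 + n) by exact/val_inj.
by rewrite (row_mxEl (x%:M : 'rV[R]_1)) mxE.
Qed.

Lemma uncons_rVK : cancel uncons_rV cons_rV.
Proof.
move=> v; apply/rowP => i; rewrite /cons_rV /uncons_rV/=.
set w := (v : 'rV[R]_(1 + n)).
case: (@split_ordP 1 n i) => j ->.
  rewrite (row_mxEl ((w ord0 ord0)%:M : 'rV[R]_1)) mxE (ord1 j) mulr1n.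
  by congr (w _ _); exact/val_inj.
by rewrite (row_mxEr ((w ord0 ord0)%:M : 'rV[R]_1)) mxE.
Qed.

Lemma preimage_cons_cube (c : 'rV[R]_n.+1) r :
  cons_rV @^-1` cube c r =
  [set x | `|c ord0 ord0 - x| < r] `*` cube (rsubmx (c : 'rV[R]_(1 + n))) r.
Proof.
have l0 : ord0 = lshift n (ord0 : 'I_1) :> 'I_(1 + n) by exact/val_inj.
apply/seteqP; split=> [[x v]/= h|[x v]/= [hx hv] i].
  split.
    have := h ord0; rewrite /cons_rV l0.
    by rewrite (row_mxEl (x%:M : 'rV[R]_1)) mxE.
  move=> i; have := h (rshift 1 i).
  by rewrite /cons_rV (row_mxEr (x%:M : 'rV[R]_1)) mxE.
case: (@split_ordP 1 n i) => j ->; rewrite /cons_rV.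
  by rewrite (row_mxEl (x%:M : 'rV[R]_1)) mxE (ord1 j) -l0.
by rewrite (row_mxEr (x%:M : 'rV[R]_1)); have := hv j; rewrite mxE.
Qed.

Lemma measurable_cons_rV : measurable_fun setT cons_rV.
Proof.
apply: (@measurability _ _ _ (borel_rV R n.+1) _ _ (@open 'rV[R]_n.+1)) => // _ [U oU <-].
rewrite setTI (open_rV_bigcup oU) preimage_bigcup bigcup_mkcond.
apply: countable_bigcupT_measurable => // -[q k]; case: ifPn => // _.
rewrite preimage_cons_cube; apply: measurableX; last exact: measurable_cube.
by apply: open_measurable; exact: (@ball_open R R).
Qed.

Lemma measurable_uncons_rV : measurable_fun setT uncons_rV.
Proof.
apply/measurable_fun_pairP; split.
  apply: (measurability _ (RGenOpens.measurableE R)) => _ [_ [a [b ->] <-]].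
  rewrite setTI; apply: open_rV_measurable.
  apply: open_comp (interval_open _ _) => // v _.
  exact: coord_continuous.
apply: (@measurability _ _ _ (borel_rV R n) _ _ (@open 'rV[R]_n)) => // _ [U oU <-].
rewrite setTI; apply: open_rV_measurable.
apply: open_comp oU => v _; exact: (@continuous_rsubmx R 1 1 n).
Qed.

(* The product of the Lebesgue measure of R with a measure on R^n, carried to
   R^(n+1) by (x, v) |-> (x, v_0, ..., v_(n-1)). *)
Section lebesgue_cons.
Variable mu : {sigma_finite_measure set (borel_rV R n) -> \bar R}.
Local Open Scope ereal_scope.

Definition lebesgue_cons : set (borel_rV R n.+1) -> \bar R :=
  pushforward (@lebesgue_measure R \x mu) cons_rV.

Let lebesgue_cons0 : lebesgue_cons set0 = 0.
Proof. by rewrite /lebesgue_cons /pushforward preimage_set0 measure0. Qed.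

Let lebesgue_cons_ge0 A : 0 <= lebesgue_cons A.
Proof. by rewrite /lebesgue_cons /pushforward; exact: measure_ge0. Qed.

Let lebesgue_cons_sigma_additive : semi_sigma_additive lebesgue_cons.
Proof.
move=> F mF tF mUF; rewrite /lebesgue_cons /pushforward preimage_bigcup.
have mcons A : measurable A -> measurable (cons_rV @^-1` A).
  by move=> mA; rewrite -[X in measurable X]setTI; exact: measurable_cons_rV.
apply: measure_semi_sigma_additive.
- by move=> i; exact: mcons.
- apply/trivIsetP => /= i j _ _ ij; rewrite -preimage_setI.
  by move/trivIsetP : tF => /(_ _ _ _ _ ij) ->//; rewrite preimage_set0.
- by rewrite -preimage_bigcup; exact: mcons.
Qed.

HB.instance Definition _ := isMeasure.Build _ _ _ lebesgue_cons
  lebesgue_cons0 lebesgue_cons_ge0 lebesgue_cons_sigma_additive.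

Let lebesgue_cons_sigma_finite : sigma_finite setT lebesgue_cons.
Proof.
have /sigma_finiteP[F [TF ndF Foo]] := sigma_finiteT (@lebesgue_measure R).
have /sigma_finiteP[G [TG ndG Goo]] := sigma_finiteT mu.
exists (fun k => uncons_rV @^-1` (F k `*` G k)).
  rewrite -preimage_bigcup; apply/esym/seteqP; split=> // v _ /=.
  have [k _ Fk] : (\bigcup_k F k) (uncons_rV v).1 by rewrite -TF.
  have [l _ Gl] : (\bigcup_k G k) (uncons_rV v).2 by rewrite -TG.
  exists (maxn k l) => //; split.
    by move: Fk; exact/subsetPset/ndF/leq_maxl.
  by move: Gl; exact/subsetPset/ndG/leq_maxr.
move=> k; have [mF Fk] := Foo k; have [mG Gk] := Goo k; split.
  rewrite -[X in measurable X]setTI.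
  by apply: measurable_uncons_rV => //; exact: measurableX.
rewrite /lebesgue_cons /pushforward.
have -> : cons_rV @^-1` (uncons_rV @^-1` (F k `*` G k)) = F k `*` G k.
  by rewrite -comp_preimage (_ : _ \o _ = id)//; apply/funext/cons_rVK.
by rewrite product_measure1E// lte_mul_pinfty// ge0_fin_numE.
Qed.

HB.instance Definition _ := @Measure_isSigmaFinite.Build _ _ _ lebesgue_cons
  lebesgue_cons_sigma_finite.

End lebesgue_cons.
End cons_rV.

Fixpoint lebesgue_rV (R : realType) (n : nat) :
    {sigma_finite_measure set (borel_rV R n) -> \bar R} :=
  if n is m.+1 then lebesgue_cons (lebesgue_rV R m)
  else @dirac _ (borel_rV R 0) (0 : 'rV[R]_0) R.

(* The norm `|v| that the library puts on 'rV[R]_n is the sup norm. *)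
Definition enorm (R : realType) (n : nat) (v : 'rV[R]_n) : R :=
  Num.sqrt (\sum_(i < n) v ord0 i ^+ 2).

Section gaussian.
Context {R : realType} {n : nat}.

Definition gaussian_pdf (x : borel_rV R n) : R :=
  (2 * pi) `^ (- (n%:R / 2)) * expR (- (enorm x ^+ 2 / 2)).

Definition gaussian : set (borel_rV R n) -> \bar R :=
  fun A => (\int[lebesgue_rV R n]_(x in A) (gaussian_pdf x)%:E)%E.

Lemma gaussian_pdf_ge0 x : 0 <= gaussian_pdf x.
Proof. by rewrite mulr_ge0 ?powR_ge0 ?expR_ge0. Qed.

Lemma measurable_coord (i : 'I_n) :
  measurable_fun setT (fun x : borel_rV R n => (x : 'rV[R]_n) ord0 i : R).
Proof.
apply: (measurability _ (RGenOpens.measurableE R)) => _ [_ [a [b ->] <-]].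
rewrite setTI; apply: open_rV_measurable.
apply: open_comp (interval_open _ _) => // v _.
exact: coord_continuous.
Qed.

Lemma measurable_gaussian_pdf : measurable_fun setT gaussian_pdf.
Proof.
apply: measurable_funM => //; apply: measurableT_comp => //.
apply: measurableT_comp => //; apply: measurable_funM => //.
apply: measurable_funX.
apply: (measurableT_comp (f := @Num.sqrt R)).
  by apply: continuous_measurable_fun; exact: sqrt_continuous.
by apply: measurable_sum => i; apply: measurable_funX; exact: measurable_coord.
Qed.

Let gaussian0 : gaussian set0 = 0%E.
Proof. by rewrite /gaussian integral_set0. Qed.

Let gaussian_ge0 A : (0 <= gaussian A)%E.
Proof. by apply: integral_ge0 => x _; rewrite lee_fin gaussian_pdf_ge0. Qed.

Let gaussian_sigma_additive : semi_sigma_additive gaussian.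
Proof.
move=> /= A mA tA mUA; rewrite /gaussian ge0_integral_bigcup//=; last 2 first.
- apply: measurable_funTS; apply/measurable_EFinP.
  exact: measurable_gaussian_pdf.
- by move=> x _; rewrite lee_fin gaussian_pdf_ge0.
apply: is_cvg_ereal_nneg_natsum_cond => k _ _.
by apply: integral_ge0 => x _; rewrite lee_fin gaussian_pdf_ge0.
Qed.

HB.instance Definition _ := isMeasure.Build _ _ _ gaussian
  gaussian0 gaussian_ge0 gaussian_sigma_additive.

End gaussian.
Arguments gaussian : clear implicits.

Section smooth.
Context {R : realType} {n : nat}.
Implicit Type f : 'rV[R]_n -> R.

Definition partial (i : 'I_n) f : 'rV[R]_n -> R :=
  fun x => 'D_(delta_mx ord0 i) f x.

Definition gradient f (x : 'rV[R]_n) : 'rV[R]_n := \row_i partial i f x.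

(* C^oo: the iterated partial derivatives of all orders exist and are
   continuous. *)
Definition smooth f : Prop :=
  forall s : seq 'I_n, let g := foldr partial f s in
    continuous g /\ forall (i : 'I_n) x, derivable g x (delta_mx ord0 i).

End smooth.

(* Main.v *)
Require Import Defs.
From HB Require Import structures.
From mathcomp Require Import all_boot all_order all_algebra.
From mathcomp Require Import all_classical all_reals all_analysis.
From mathcomp Require Import measurable_realfun.
From mathcomp Require Import ring lra zify.

(* With [Phi q = 8 e^q / sqrt (1 + q)] and
     [M (a, b) = ln a + Phi (|b|^2 / (2 a^2))],
   the claim is the functional inequality
     [M (int g, 0) <= int M (g, grad g)]   for [g = e^f],
   where [M (int g, 0) = ln (int e^f) + 8] leaves a slack of [8].
   In dimension one it is proved together with a passive variable [h],
     [M (int g, int h) <= int M (g, (h, g'))],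
   by letting [t] run from [0] to [pi / 2] in
     [int M (A_t g, (A_t h, sin t A_t g'))], where
     [A_t u z = int u (z sin t + w cos t) dgamma(w)]:
   after a Gaussian integration by parts the derivative in [t] is the integral
   of a quadratic form, which is nonnegative because
     [2 q Phi'^2 <= (Phi' - 1) (2 q Phi'' + Phi')].
   Integrating out one coordinate at a time, with [h] the component of the
   remaining gradient along its own mean, gives every dimension for functions
   [g] bounded below with bounded derivatives.  A general [f] is approximated by
   [(1 - eps) eta L sin (f / L)] with a cutoff [eta], which increases
   [Phi (|grad f|^2 / 2)] by at most [6 < 8]; Fatou's lemma concludes. *)

Set Implicit Arguments.
Unset Strict Implicit.
Unset Printing Implicit Defensive.

Import Order.TTheory GRing.Theory Num.Theory.
Import numFieldNormedType.Exports.

Local Open Scope classical_set_scope.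
Local Open Scope ring_scope.

(** The logarithm in [M] is what brings in the mean: [int ln g = int f = 0], while
    [|grad g| / g = |grad f|]. The obstacle is that [M] is not convex: on the axis [(g, 0)] it is a
    logarithm plus a constant, so Jensen's inequality fails. The repair comes from the explicit
    factor [sin t] in the last slot. Its own derivative adds a term [Phi' (A_t g' / A_t g)^2], up to
    the factor [sin t] that the Hessian term carries too, and the coefficient [-1] of the logarithm
    becomes [Phi' - 1 > 0]. The condition on [Phi] is then a discriminant condition. An angle
    instead of a time keeps all coefficients smooth at both ends, where [A_t] is the mean and the
    identity. One scalar [h] serves every dimension, because only the length of the mean gradient
    enters [M] and because [Phi] increases. In the limit, a cutoff creates gradient where [f] has
    little. A crude bound by [Phi (1/2) <= 14], against the least value [Phi 0 = 8], is affordable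
    there; what remains of the slack absorbs the mean of the approximant, which only tends to
    [0]. *)

Section derive_lambda.
Context {R : realType}.
Implicit Types (f g F : R -> R) (x a b : R).

(** Stated for explicit [fun t => ...], these rules let a derivative be assembled by nesting terms,
    which leaves one closing identity for [ring] or [field]. *)
Lemma is_derive_lamD f g x a b : is_derive x 1 f a -> is_derive x 1 g b ->
  is_derive x 1 (fun t => f t + g t) (a + b).
Proof. by move=> fa gb; exact: is_deriveD. Qed.

Lemma is_derive_lamB f g x a b : is_derive x 1 f a -> is_derive x 1 g b ->
  is_derive x 1 (fun t => f t - g t) (a - b).
Proof. by move=> fa gb; exact: is_deriveB. Qed.

Lemma is_derive_lamM f g x a b : is_derive x 1 f a -> is_derive x 1 g b ->
  is_derive x 1 (fun t => f t * g t) (a * g x + f x * b).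
Proof.
move=> fa gb; apply: (is_derive_eq (is_deriveM fa gb)).
by rewrite /GRing.scale/= addrC [g x * a]mulrC.
Qed.

Lemma is_derive_lamZ f x a c : is_derive x 1 f a ->
  is_derive x 1 (fun t => c * f t) (c * a).
Proof.
move=> fa; have := is_derive_lamM (is_derive_cst c x 1) fa.
by rewrite mul0r add0r.
Qed.

Lemma is_derive_lamV f x a : f x != 0 -> is_derive x 1 f a ->
  is_derive x 1 (fun t => (f t)^-1) (- a / f x ^+ 2).
Proof.
move=> f0 fa; apply: (is_derive_eq (is_deriveV f0 fa)).
by rewrite /GRing.scale/= !mulNr mulrC.
Qed.

Lemma is_derive_lamX f x a n : is_derive x 1 f a ->
  is_derive x 1 (fun t => f t ^+ n.+1) (n.+1%:R * f x ^+ n * a).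
Proof.
move=> fa; have := is_deriveX n.+1 fa; rewrite exprfctE => ?; exact: is_derive_eq.
Qed.

Lemma is_derive_lam_comp F f x a b : is_derive (f x) 1 F b ->
  is_derive x 1 f a -> is_derive x 1 (fun t => F (f t)) (b * a).
Proof. by move=> Fb fa; exact: is_derive1_comp. Qed.

End derive_lambda.

(** * The profile Phi *)

Section Phi.
Context {R : realType}.
Implicit Types q x y : R.

(** A single exponential instead of a quotient by [Num.sqrt]: each derivative is then [Phi] times a
    rational function of [q]. *)
Definition Phi q : R := 8 * expR (q - ln (1 + q) / 2).
Definition Phi' q : R := Phi q * (1 - (2 * (1 + q))^-1).
Definition Phi'' q : R :=
  Phi q * ((1 - (2 * (1 + q))^-1) ^+ 2 + (2 * (1 + q) ^+ 2)^-1).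

Lemma sqrt_expR x : Num.sqrt (expR x) = expR (x / 2).
Proof.
rewrite -[RHS]ger0_norm ?expR_ge0// -sqrtr_sqr; congr Num.sqrt.
by rewrite expr2 -expRD -splitr.
Qed.

Lemma PhiE q : 0 <= q -> Phi q = 8 * (expR q / Num.sqrt (1 + q)).
Proof.
move=> q0; have q1 : 0 < 1 + q by rewrite ltr_wpDr.
by rewrite /Phi expRB -sqrt_expR lnK.
Qed.

Lemma is_derive_Phi q : 0 <= q -> is_derive q 1 Phi (Phi' q).
Proof.
move=> q0; have q1 : 0 < 1 + q by rewrite ltr_wpDr.
have d1 := is_derive_lamD (is_derive_cst (1 : R) q 1) (is_derive_id q 1).
have dl := is_derive_lam_comp (is_derive1_ln q1) d1.
have d2 := is_derive_lamZ 2^-1 dl.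
have d3 := is_derive_lamB (is_derive_id q 1) d2.
have d4 := is_derive_lamZ 8 (is_derive_lam_comp (is_derive_expR _) d3).
rewrite /Phi; under eq_fun do rewrite [_ / 2]mulrC.
apply: (@is_derive_eq R R R _ q 1 _ _ d4).
rewrite /Phi' /Phi [_ / 2]mulrC invfM; ring.
Qed.

Lemma is_derive_Phi' q : 0 <= q -> is_derive q 1 Phi' (Phi'' q).
Proof.
move=> q0; have q1 : 0 < 1 + q by rewrite ltr_wpDr.
have n1 : 1 + q != 0 by rewrite gt_eqF.
have n2 : 2 * (1 + q) != 0 by rewrite mulf_neq0.
have d1 := is_derive_lamD (is_derive_cst (1 : R) q 1) (is_derive_id q 1).
have d2 := @is_derive_lamV _ (fun t => 2 * (1 + t)) _ _ n2 (is_derive_lamZ 2 d1).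
have d3 := is_derive_lamB (is_derive_cst (1 : R) q 1) d2.
have d4 := is_derive_lamM (is_derive_Phi q0) d3.
apply: (@is_derive_eq R R R _ q 1 _ _ d4).
rewrite /Phi' /Phi'' /=. by field; lra.
Qed.

(** Turns [Phi_ge8] and [Phi_disc] into polynomial inequalities. It combines
    [sqrt (1 + q) <= 1 + q / 2] with [e^q = (e^(q/4))^4 >= (1 + q / 4)^4]. *)
Lemma ler1D4X q : 0 <= q -> 1 + q / 2 + q ^+ 2 / 8 <= expR q / Num.sqrt (1 + q).
Proof.
move=> q0; have q1 : 0 < 1 + q by rewrite ltr_wpDr.
rewrite ler_pdivlMr ?sqrtr_gt0//.
have s : Num.sqrt (1 + q) <= 1 + q / 2.
  rewrite -(@ger0_norm _ (1 + q / 2)); last lra.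
  rewrite -sqrtr_sqr ler_sqrt; nra.
have e : (1 + q / 4) ^+ 4 <= expR q.
  have -> : expR q = expR (q / 4) ^+ 4.
    by rewrite -expRM_natl; congr expR; field.
  by rewrite lerXn2r ?nnegrE ?expR_ge0 ?expR_ge1Dx//; lra.
apply: le_trans e.
(* The product of the quadratic with [1 + q / 2] agrees with [(1 + q / 4) ^+ 4] up to the last term
   [q ^+ 4 / 256]. *)
apply: (@le_trans _ _ ((1 + q / 2 + q ^+ 2 / 8) * (1 + q / 2))).
  by rewrite ler_wpM2l//; nra.
have : 0 <= q ^+ 4 by rewrite exprn_ge0.
nra.
Qed.

Lemma Phi_ge8 q : 0 <= q -> 8 <= Phi q.
Proof.
move=> q0; rewrite PhiE//; have := ler1D4X q0.
have : 0 <= q ^+ 2 by rewrite exprn_ge0.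
nra.
Qed.

Lemma Phi'_ge4 q : 0 <= q -> 4 <= Phi' q.
Proof.
move=> q0; have := Phi_ge8 q0; rewrite /Phi' => P8.
have : (2 * (1 + q))^-1 <= 2^-1.
  by rewrite lef_pV2 ?posrE; lra.
nra.
Qed.

Lemma Phi_disc q : 0 <= q ->
  2 * q * Phi' q ^+ 2 <= (Phi' q - 1) * (2 * q * Phi'' q + Phi' q).
Proof.
move=> q0; have q1 : 0 < 1 + q by rewrite ltr_wpDr.
have := ler1D4X q0; have := PhiE q0; set E := expR q / _ => PE E1.
rewrite -subr_ge0 /Phi' /Phi'' PE.
(* One factor [E] splits off, and the bracket is affine in [E] with positive slope, so the lower
   bound on [E] can be inserted. *)
have -> : (8 * E * (1 - (2 * (1 + q))^-1) - 1) * (2 * q * (8 * E *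
  ((1 - (2 * (1 + q))^-1) ^+ 2 + (2 * (1 + q) ^+ 2)^-1)) +
  8 * E * (1 - (2 * (1 + q))^-1)) -
  2 * q * (8 * E * (1 - (2 * (1 + q))^-1)) ^+ 2 =
  4 * E / (1 + q) ^+ 3 * 
  (4 * E * (1 + 2 * q) * (1 + 4 * q) - ((1 + q) * (1 + 4 * q) +
     2 * q * (1 + q) ^+ 2 * (1 + 2 * q))).
  field; lra.
have E0 : 0 <= E by nra.
apply: mulr_ge0.
  by apply: divr_ge0; [lra | apply: exprn_ge0; lra].
rewrite subr_ge0.
have A0 : 0 <= 4 * (1 + 2 * q) * (1 + 4 * q) by nra.
(* With [1 + q / 2 + q ^+ 2 / 8] inserted, both sides have leading term [4 * q ^+ 4]: the
   coefficient [1 / 8] is the least that works. *)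
have := ler_wpM2l A0 E1.
have : 0 <= q ^+ 4 by rewrite exprn_ge0.
have : 0 <= q ^+ 3 by rewrite exprn_ge0.
have : 0 <= q ^+ 2 by rewrite exprn_ge0.
nra.
Qed.

(** In the application [k] is the logarithmic derivative of [a], [s] the derivative of [q], and [D]
    the squared speed of [(b, c) / a], a vector of squared length [2 q]; the bound on [s] is
    Cauchy-Schwarz. At the least [D], namely [s^2 / (2 q)], a quadratic form in [(k, s)] remains,
    and [Phi_disc] is its discriminant condition. *)
Lemma Phi_form_ge0 q k s D : 0 <= q -> 0 <= D -> s ^+ 2 <= 2 * q * D ->
  0 <= (Phi' q - 1) * k ^+ 2 - 2 * Phi' q * k * s + Phi' q * D + Phi'' q * s ^+ 2.
Proof.
move=> q0 D0 sD; have := Phi'_ge4 q0; have := Phi_disc q0.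
set p := Phi' q; set p' := Phi'' q => disc p4.
move: q0; rewrite le_eqVlt => /predU1P[q0|q0].
  (* At [q = 0] the square cannot be completed by multiplying with [q], but there [s] vanishes. *)
  move: sD; rewrite -q0 mulr0 mul0r => s0.
  have {s0}-> : s = 0 by apply/eqP; rewrite -sqrf_eq0 eq_le s0 sqr_ge0.
  rewrite mulr0 expr0n/= mulr0 subr0 addr0.
  by apply: addr_ge0; apply: mulr_ge0; rewrite ?sqr_ge0//; lra.
rewrite -(@pmulr_rge0 _ (2 * q * (p - 1))); last by rewrite !mulr_gt0// subr_gt0; lra.
apply: (@le_trans _ _ (2 * q * ((p - 1) * k - p * s) ^+ 2)).
  by rewrite mulr_ge0 ?sqr_ge0//; lra.
rewrite -subr_ge0.
have -> : 2 * q * (p - 1) * ((p - 1) * k ^+ 2 - 2 * p * k * s + p * D + p' * s ^+ 2)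
  - 2 * q * ((p - 1) * k - p * s) ^+ 2 =
  (p - 1) * p * (2 * q * D - s ^+ 2) +
  ((p - 1) * (2 * q * p' + p) - 2 * q * p ^+ 2) * s ^+ 2 by ring.
apply: addr_ge0; apply: mulr_ge0; rewrite ?sqr_ge0 ?subr_ge0//.
by rewrite mulr_ge0 ?subr_ge0//; lra.
Qed.

Lemma ler_Phi x y : 0 <= x -> x <= y -> Phi x <= Phi y.
Proof.
move=> x0 xy.
apply: (ger0_derive1_ndecr (a := x) (b := y) _ _ _ (lexx x) xy (lexx y)).
- move=> z; rewrite in_itv/= => /andP[xz _].
  by have [] := is_derive_Phi (le_trans x0 (ltW xz)).
- move=> z; rewrite in_itv/= => /andP[xz _].
  have z0 := le_trans x0 (ltW xz); have dz := is_derive_Phi z0.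
  by rewrite derive1E derive_val (le_trans _ (Phi'_ge4 z0)).
- apply: derivable_within_continuous => z; rewrite in_itv/= => /andP[xz _].
  by have [] := is_derive_Phi (le_trans x0 xz).
Qed.

(** The bound [14] is [6] above the least value [8] of [Phi] on [q >= 0]. It needs only
    [e^(1/2) <= 2], from [e^(-1/2) >= 1/2], and [sqrt (3/2) >= 12/10]. *)
Lemma Phi_half : Phi (2^-1) <= 14.
Proof.
rewrite PhiE//; have := expR_ge1Dx (- (2^-1 : R)); rewrite expRN.
set e := expR _ => e2.
have e0 : 0 < e by exact: expR_gt0.
have {}e2 : e <= 2.
  rewrite -(invrK e) -[leRHS]invrK lef_pV2 ?posrE ?invr_gt0//; lra.
have s : 12 / 10 <= Num.sqrt (1 + 2^-1 : R).
  rewrite -(@ger0_norm _ (12 / 10 : R)); last lra.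
  rewrite -sqrtr_sqr ler_sqrt; lra.
have s0 : 0 < Num.sqrt (1 + 2^-1 : R) by lra.
have : e / Num.sqrt (1 + 2^-1) <= 14 / 8 by rewrite ler_pdivrMr//; lra.
lra.
Qed.

Lemma expR_sqrt_le x : 0 <= x ->
  8 * (expR (x ^+ 2 / 2) / Num.sqrt (1 + x ^+ 2 / 2)) <=
  14 * (expR (x ^+ 2 / 2) / (1 + x)).
Proof.
move=> x0; set E := expR _; have E0 : 0 < E by exact: expR_gt0.
have s0 : 0 < 1 + x ^+ 2 / 2 by have := sqr_ge0 x; lra.
set s := Num.sqrt _; have sp : 0 < s by rewrite sqrtr_gt0.
have s2 : s ^+ 2 = 1 + x ^+ 2 / 2 by rewrite sqr_sqrtr// ltW.
rewrite !mulrA ler_pdivrMr// mulrAC ler_pdivlMr; last lra.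
rewrite mulrAC [leRHS]mulrAC ler_pM2r//.
rewrite -(@ler_pXn2r _ 2) ?nnegrE//; [|lra|lra].
rewrite [leRHS]exprMn s2 -subr_ge0.
(* The difference of the squares is a quadratic in [x] with minimum [196 / 17], attained at
   [32 / 17]. *)
have -> : 14 ^+ 2 * (1 + x ^+ 2 / 2) - (8 * (1 + x)) ^+ 2 =
  34 * (x - 32 / 17) ^+ 2 + 196 / 17 by field.
by rewrite addr_ge0// mulr_ge0// sqr_ge0.
Qed.

End Phi.

(** * Integration against the standard normal law *)

Section normal_density.
Local Open Scope charge_scope.
Context {R : realType} (m s : R).
Local Notation mu := (@lebesgue_measure R).
Local Notation nu := (normal_prob m s).

(** Both densities integrate to the [nu]-measure of [E] over every measurable [E]. *)
Lemma ae_eq_Radon_Nikodym_normal : ae_eq mu setT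
  ('d (charge_of_finite_measure nu) '/d mu) (EFin \o normal_pdf m s).
Proof.
have dom := @normal_prob_dominates R m s.
apply: integral_ae_eq => //.
- exact: Radon_Nikodym_integrable.
- by apply/measurable_EFinP; exact: measurable_normal_pdf.
- by move=> E _ mE; rewrite -Radon_Nikodym_integral.
Qed.

Lemma integral_normal_prob f : nu.-integrable setT f ->
  (\int[nu]_x f x = \int[mu]_x (f x * (normal_pdf m s x)%:E))%E.
Proof.
move=> intf; have dom := @normal_prob_dominates R m s.
rewrite -(Radon_Nikodym_change_of_variables dom)//.
have mf := measurable_int _ intf.
apply: ae_eq_integral => //.
- exact: emeasurable_funM.
- apply: emeasurable_funM => //.
  by apply/measurable_EFinP; exact: measurable_normal_pdf.
- apply: ae_eqe_mul2l; exact: ae_eq_Radon_Nikodym_normal.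
Qed.

Lemma ge0_integral_normal_prob f : measurable_fun setT f ->
  (forall x, 0 <= f x)%E ->
  (\int[nu]_x f x = \int[mu]_x (f x * (normal_pdf m s x)%:E))%E.
Proof.
move=> mf f0; have dom := @normal_prob_dominates R m s.
rewrite -(Radon_Nikodym_SigmaFinite.change_of_variables dom)//.
apply: ae_eq_integral => //.
- apply: emeasurable_funM => //.
  apply: measurable_int; exact: Radon_Nikodym_SigmaFinite.f_integrable.
- apply: emeasurable_funM => //.
  by apply/measurable_EFinP; exact: measurable_normal_pdf.
- apply: ae_eqe_mul2l; apply: ae_eq_trans; last exact: ae_eq_Radon_Nikodym_normal.
  exact: ae_eq_Radon_Nikodym_SigmaFinite.
Qed.

End normal_density.

(** * Bounded functions *)

Section bounded.
Context {R : realType} {T : Type}.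
Implicit Types f g : T -> R.

Definition bnd f := exists C, forall x, `|f x| <= C.

Lemma bnd_cst c : bnd (fun=> c). Proof. by exists `|c|. Qed.

Lemma bndD f g : bnd f -> bnd g -> bnd (fun x => f x + g x).
Proof.
move=> [C fC] [D gD].
by exists (C + D) => x; rewrite (le_trans (ler_normD _ _))// lerD.
Qed.

Lemma bndN f : bnd f -> bnd (fun x => - f x).
Proof. by move=> [C fC]; exists C => x; rewrite normrN. Qed.

Lemma bndB f g : bnd f -> bnd g -> bnd (fun x => f x - g x).
Proof. by move=> bf bg; exact: bndD (bndN bg). Qed.

Lemma bndM f g : bnd f -> bnd g -> bnd (fun x => f x * g x).
Proof.
move=> [C fC] [D gD].
by exists (C * D) => x; rewrite normrM ler_pM.
Qed.

Lemma bndV f c : 0 < c -> (forall x, c <= f x) -> bnd (fun x => (f x)^-1).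
Proof.
move=> c0 cf; exists c^-1 => x; have fx : 0 < f x by exact: lt_le_trans (cf x).
by rewrite ger0_norm ?invr_ge0 ?(ltW fx)// lef_pV2.
Qed.

Lemma bnd_ln f c : 0 < c -> (forall x, c <= f x) -> bnd f ->
  bnd (fun x => ln (f x)).
Proof.
move=> c0 cf [C fC]; exists (`|ln c| + `|ln C|) => x.
have fx : 0 < f x by exact: lt_le_trans (cf x).
have fxC : f x <= C by rewrite (le_trans _ (fC x))// ler_norm.
have l1 : ln c <= ln (f x) by rewrite ler_ln.
have l2 : ln (f x) <= ln C by rewrite ler_ln ?posrE// (lt_le_trans fx).
rewrite ler_norml; apply/andP; split.
  by have := lerNnormlW (lexx `|ln c|); have := normr_ge0 (ln C); lra.
by have := ler_norm (ln C); have := normr_ge0 (ln c); lra.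
Qed.

Lemma bnd_Phi f : (forall x, 0 <= f x) -> bnd f -> bnd (fun x => Phi (f x)).
Proof.
move=> f0 [C fC]; exists (Phi C) => x.
have fxC : f x <= C by rewrite (le_trans _ (fC x))// ler_norm.
by rewrite ger0_norm ?ler_Phi// (le_trans _ (Phi_ge8 (f0 x))).
Qed.

Lemma bnd_Phi' f : (forall x, 0 <= f x) -> bnd f -> bnd (fun x => Phi' (f x)).
Proof.
move=> f0 bf; apply: bndM; first exact: bnd_Phi.
apply: bndB; first exact: bnd_cst.
apply: (@bndV _ 2) => // x; have := f0 x; lra.
Qed.

Lemma bnd_Phi'' f : (forall x, 0 <= f x) -> bnd f -> bnd (fun x => Phi'' (f x)).
Proof.
move=> f0 bf; apply: bndM; first exact: bnd_Phi.
have b1 : bnd (fun x => 1 - (2 * (1 + f x))^-1).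
  apply: bndB; first exact: bnd_cst.
  apply: (@bndV _ 2) => // x; have := f0 x; lra.
apply: bndD.
  by under [X in bnd X]eq_fun do rewrite expr2; exact: bndM.
apply: (@bndV _ 2) => // x; have := f0 x; nra.
Qed.

End bounded.

Section bounded_measurable.
Context {R : realType} d (T : measurableType d).
Implicit Types f g : T -> R.

(** Such functions are integrable for every finite measure, so integrability reduces to following
    bounds through explicit formulas. *)
Definition bmfun f := measurable_fun setT f /\ bnd f.

Lemma bmfun_cst c : bmfun (cst c).
Proof. by split => //; exact: bnd_cst. Qed.

Lemma bmfunD f g : bmfun f -> bmfun g -> bmfun (fun x => f x + g x).
Proof.
by move=> [mf bf] [mg bg]; split; [exact: measurable_funD|exact: bndD].
Qed.

Lemma bmfunM f g : bmfun f -> bmfun g -> bmfun (fun x => f x * g x).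
Proof.
by move=> [mf bf] [mg bg]; split; [exact: measurable_funM|exact: bndM].
Qed.

Lemma bmfun_sum (I : Type) (r : seq I) (F : I -> T -> R) :
  (forall i, bmfun (F i)) -> bmfun (fun x => \sum_(i <- r) F i x).
Proof.
move=> bF; elim: r => [|i r IH].
  by under eq_fun do rewrite big_nil; exact: bmfun_cst.
by under eq_fun do rewrite big_cons; exact: bmfunD.
Qed.

Lemma bmfun_integrable (mu : {finite_measure set T -> \bar R}) f :
  bmfun f -> mu.-integrable setT (EFin \o f).
Proof.
move=> [mf [C fC]]; apply: measurable_bounded_integrable => //.
  by rewrite -ge0_fin_numE// fin_num_measure.
exists C; split; first exact: num_real.
by move=> y Cy x _; rewrite /= (le_trans (fC x))// ltW.
Qed.

End bounded_measurable.

Lemma bmfun_comp (R : realType) d (T : measurableType d) d'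
    (U : measurableType d') (h : U -> T) (f : T -> R) :
  measurable_fun setT h -> bmfun f -> bmfun (f \o h).
Proof.
by move=> mh [mf [C fC]]; split; [exact: measurableT_comp|exists C => x /=].
Qed.

Section gauss1.
Context {R : realType}.
Local Notation mu := (@lebesgue_measure R).
Local Notation g1 := (normal_prob (0 : R) 1).
Local Notation pdf := (normal_pdf (0 : R) 1).

Lemma stdnormal_pdfE x : pdf x = normal_peak 1 * expR (- (x ^+ 2 / 2)).
Proof.
rewrite normal_pdfE ?oner_neq0// /normal_fun subr0 expr1n.
by rewrite mulNr.
Qed.

(** Since [|x| <= 1 + x^2 / 4 <= e^(x^2 / 4)], the integrand [|x| e^(-x^2 / 2)] is at most
    [e^(-x^2 / 4)], a multiple of the normal density of variance [2]. *)
Lemma integrable_stdnormal_id : g1.-integrable setT (EFin \o (@id R)).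
Proof.
apply/integrableP; split; first exact/measurable_EFinP.
rewrite ge0_integral_normal_prob//=; last first.
  by apply/measurable_EFinP.
have s2 : Num.sqrt 2 != 0 :> R by rewrite gt_eqF// sqrtr_gt0.
pose c := normal_peak 1 / normal_peak (Num.sqrt 2) : R.
have c0 : 0 <= c by rewrite divr_ge0// normal_peak_ge0.
have int2 : mu.-integrable setT (fun x => (c * normal_pdf 0 (Num.sqrt 2) x)%:E).
  under eq_fun do rewrite EFinM.
  by apply: integrableZl => //; exact: integrable_normal_pdf.
apply: (@le_lt_trans _ _ (\int[mu]_x (c * normal_pdf 0 (Num.sqrt 2) x)%:E))%E; last first.
  have /integrableP[_] := int2.
  congr (_ < _)%E; apply: eq_integral => x _ /=.
  by rewrite ger0_norm// mulr_ge0// normal_pdf_ge0.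
apply: ge0_le_integral => //=.
- by move=> x _; rewrite -EFinM lee_fin mulr_ge0// normal_pdf_ge0.
- apply/measurable_EFinP/measurable_funM => //.
  exact: measurable_normal_pdf.
- by have /integrableP[] := int2.
move=> x _; rewrite -EFinM lee_fin stdnormal_pdfE normal_pdfE//=.
rewrite /c [leRHS]mulrA divfK; last by rewrite gt_eqF// normal_peak_gt0.
rewrite mulrCA ler_wpM2l ?normal_peak_ge0//.
rewrite /normal_fun subr0 sqr_sqrtr// -[2 *+ 2]mulr_natr.
have -> : - (x ^+ 2 / 2) = - (x ^+ 2 / 4) + - (x ^+ 2 / 4) by field.
have -> : - x ^+ 2 / (2 * 2%:R) = - (x ^+ 2 / 4) by field.
rewrite expRD mulrA ler_piMl ?expR_ge0// expRN ler_pdivrMr ?expR_gt0// mul1r.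
apply: le_trans (expR_ge1Dx _).
rewrite -[x ^+ 2]real_normK ?num_real//.
have := sqr_ge0 (`|x| - 2); nra.
Qed.

End gauss1.

(** * Gaussian integration by parts *)

Section ibp.
Context {R : realType}.
Local Notation mu := (@lebesgue_measure R).
Local Notation g1 := (normal_prob (0 : R) 1).
Local Notation pdf := (normal_pdf (0 : R) 1).

Lemma is_derive_stdnormal_pdf (x : R) : is_derive x 1 (pdf : R -> R) (- x * pdf x).
Proof.
have -> : pdf = fun x => normal_peak 1 * expR (- 2^-1 * (x * x)).
  apply/funext => y; rewrite stdnormal_pdfE; congr (_ * expR _).
  by rewrite expr2; ring.
have d2 := is_derive_lamM (is_derive_id x 1) (is_derive_id x 1).
have d3 := is_derive_lam_comp (is_derive_expR _) (is_derive_lamZ (- 2^-1) d2).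
apply: (is_derive_eq (is_derive_lamZ (normal_peak 1) d3)).
by field.
Qed.

Lemma stdnormal_pdf_le x : pdf x <= normal_peak 1 * (1 + x ^+ 2 / 2)^-1.
Proof.
rewrite stdnormal_pdfE ler_wpM2l ?normal_peak_ge0//.
rewrite expRN lef_pV2 ?posrE ?expR_gt0 ?expR_ge1Dx//.
by have := sqr_ge0 x; lra.
Qed.

Lemma integrable_normal_probP (f : R -> R) : g1.-integrable setT (EFin \o f) ->
  mu.-integrable setT (fun x => (f x * pdf x)%:E).
Proof.
move=> /integrableP[mf fi]; apply/integrableP; split.
  apply/measurable_EFinP/measurable_funM; first exact/measurable_EFinP.
  exact: measurable_normal_pdf.
move: fi; rewrite ge0_integral_normal_prob//=; last first.
  by apply/measurable_EFinP/measurableT_comp => //; exact/measurable_EFinP.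
congr (_ < _)%E; apply: eq_integral => x _.
by rewrite normrM [`|pdf x|]ger0_norm// normal_pdf_ge0.
Qed.

Lemma integral_segment_cvg (f : R -> R) : mu.-integrable setT (EFin \o f) ->
  (\int[mu]_(x in `[(- n.+1%:R)%R, n.+1%:R]) (f x)%:E)%E @[n --> \oo] -->
  (\int[mu]_x (f x)%:E)%E.
Proof.
move=> fi.
have mf : measurable_fun setT (EFin \o f) by exact: measurable_int fi.
under eq_cvg do rewrite integral_mkcond.
apply: (@dominated_cvg _ _ _ mu setT _ _ _ (abse \o (EFin \o f))) => //.
- move=> n; apply/(measurable_restrictT _ _).1 => //.
  exact: measurable_funTS.
- move=> x _; apply: cvg_near_cst; near=> n.
  rewrite patchE ifT// inE/= in_itv/= -ler_norml.
  rewrite (@le_trans _ _ n%:R) ?ler_nat//; near: n.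
  exact: nbhs_infty_ger.
- exact: integrable_abse.
- move=> n x _; rewrite patchE; case: ifPn => //= _.
  by rewrite normr0 lee_fin.
Unshelve. all: end_near. Qed.

(** As [(u pdf)' = (u' - x u) pdf], the fundamental theorem of calculus on [[-N, N]] leaves a
    boundary term, which tends to [0]. *)
Lemma gauss_ibp (u u' : R -> R) (C : R) :
  (forall x : R, is_derive x 1 u (u' x)) -> continuous u' ->
  (forall x, `|u x| <= C) -> (forall x, `|u' x| <= C) ->
  \int[g1]_x (x * u x) = \int[g1]_x u' x.
Proof.
move=> du cu' uC u'C.
have cu : continuous u.
  by move=> x; apply/differentiable_continuous/derivable1_diffP; have [] := du x.
have mu_ : measurable_fun setT u by exact: continuous_measurable_fun.
have iu' : g1.-integrable setT (EFin \o u').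
  apply: bmfun_integrable; split; first exact: continuous_measurable_fun.
  by exists C.
have ixu : g1.-integrable setT (EFin \o (fun x => x * u x)).
  apply: (@le_integrable _ _ _ g1 setT measurableT _ (fun x => C%:E * x%:E)%E).
  - exact/measurable_EFinP/measurable_funM.
  - by move=> x _; rewrite /= lee_fin !normrM mulrC ler_wpM2r// (le_trans (uC x))// ler_norm.
  - by apply: integrableZl => //; exact: integrable_stdnormal_id.
apply/esym/eqP; rewrite -subr_eq0 -RintegralB//; apply/eqP.
pose W (x : R) := (u' x - x * u x) * pdf x.
have iD : g1.-integrable setT (EFin \o (fun x => u' x - x * u x)).
  rewrite /comp; under eq_fun do rewrite EFinB.
  exact: integrableB.
have iW := integrable_normal_probP iD.
rewrite /Rintegral integral_normal_prob//.
rewrite (_ : (\int[mu]_x _)%E = 0%E)//.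
pose H (x : R) := u x * pdf x.
have dH (x : R) : is_derive x 1 H (W x).
  apply: (is_derive_eq (is_derive_lamM (du x) (is_derive_stdnormal_pdf x))).
  rewrite /W; ring.
have cpdf : continuous (pdf : R -> R) by apply: continuous_normal_pdf; rewrite oner_neq0.
have cW : continuous W.
  move=> x; apply: cvgM; last exact: cpdf.
  apply: cvgB; first exact: cu'.
  by apply: cvgM; [exact: cvg_id|exact: cu].
have cH : continuous H by move=> x; apply: cvgM; [exact: cu|exact: cpdf].
have := integral_segment_cvg iW.
rewrite (_ : (fun n => _) = fun n : nat => (H n.+1%:R - H (- n.+1%:R))%:E); last first.
  apply/funext => n; rewrite EFinB; apply: continuous_FTC2.
  - by rewrite gtrN.
  - exact: continuous_subspaceT.
  - split; first by move=> x _; have [] := dH x.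
      by apply: cvg_at_right_filter; exact: cH.
    by apply: cvg_at_left_filter; exact: cH.
  - by move=> x _; rewrite derive1E; have ? := dH x; rewrite derive_val.
have H0 : (H n.+1%:R - H (- n.+1%:R)) @[n --> \oo] --> (0 : R).
  have C0 : 0 <= C by rewrite (le_trans _ (uC 0)).
  (* For bounded [u] a crude decay of the density is enough: [1 + N^2 / 2 >= N]. *)
  have Hle (x : R) (N : R) : 0 < N -> x ^+ 2 = N ^+ 2 -> `|H x| <= C * normal_peak 1 * N^-1.
    move=> N0 xN; rewrite normrM -mulrA ler_pM//.
    rewrite ger0_norm ?normal_pdf_ge0// (le_trans (stdnormal_pdf_le _))//.
    rewrite ler_wpM2l ?normal_peak_ge0// xN lef_pV2 ?posrE//; nra.
  apply: norm_cvg0.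
  have h0 : (C * normal_peak 1 *+ 2 * harmonic n) @[n --> \oo] --> (0 : R).
    by rewrite -[X in _ --> X](mulr0 (C * normal_peak 1 *+ 2)); apply: cvgMr; exact: cvg_harmonic.
  apply: (squeeze_cvgr _ (cvg_cst 0) h0).
  apply: nearW => n; rewrite normr_ge0/= (le_trans (ler_normB _ _))//.
  by rewrite mulrnAl mulr2n lerD// Hle ?sqrrN.
move=> Wc; apply: (cvg_unique _ Wc) => //.
by apply: cvg_EFin => //; exact: nearW.
Qed.

End ibp.

Lemma is_derive_under_integral (R : realType) d (T : measurableType d)
    (mu : {measure set T -> \bar R}) (f f' : R -> T -> R) (G : T -> R) (a : R) :
  (forall x, mu.-integrable setT (EFin \o f x)) ->
  (forall (x : R) y, is_derive x 1 (f ^~ y) (f' x y)) ->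
  mu.-integrable setT (EFin \o G) ->
  (forall x y, `|f' x y| <= G y) ->
  is_derive a 1 (fun x => \int[mu]_y f x y) (\int[mu]_y f' a y).
Proof.
move=> fi fd Gi f'G.
(* The domination by [G] holds for every parameter, so any interval around [a] serves. *)
have Ia : `]a - 1, a + 1[%classic a by rewrite /= in_itv/= ltrDl ltrBlDr ltrDl ltr01.
have dE x y : (partial1of2 f) x y = f' x y.
  by rewrite partial1of2E; have ? := fd x y; rewrite derive_val.
have G0 y : 0 <= G y by rewrite (le_trans _ (f'G 0 y)).
have fd1 x y : `]a - 1, a + 1[%classic x -> setT y -> derivable (f ^~ y) x 1.
  by move=> _ _; have [] := fd x y.
have fG x y : `]a - 1, a + 1[%classic x -> setT y -> `|(partial1of2 f) x y| <= G y.
  by move=> _ _; rewrite dE.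
have fi1 x : `]a - 1, a + 1[%classic x -> mu.-integrable setT (EFin \o f x) by [].
apply: DeriveDef.
  exact: (derivable_under_integral measurableT Ia fi1 fd1 G0 Gi fG).
rewrite -derive1E (differentiation_under_integral measurableT Ia fi1 fd1 G0 Gi fG).
by apply: eq_Rintegral => y _; exact: dE.
Qed.

(** * The one-dimensional inequality *)

Section heat.
Context {R : realType}.
Local Notation g1 := (normal_prob (0 : R) 1).
Implicit Types (u : R -> R) (t x z : R).

(** Only [u] is bounded here: chains [bder g0 g1], [bder g1 g2], ... bound each derivative in turn,
    and each is continuous because the next one exists. *)
Definition bder u u' := (forall x, is_derive x 1 u (u' x)) /\ bnd u.

Lemma bder_cont u u' : bder u u' -> continuous u.
Proof.
move=> [du _] x; apply/differentiable_continuous/derivable1_diffP.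
by have [] := du x.
Qed.

Lemma bder_bmfun u u' : bder u u' -> bmfun u.
Proof.
move=> ud; split; last by have [_] := ud.
exact: continuous_measurable_fun (bder_cont ud).
Qed.

(** Mehler's form of the Ornstein-Uhlenbeck semigroup at time [- ln (sin t)]. *)
Definition avg u t z := \int[g1]_w u (z * sin t + w * cos t).

Let bmfun_lin u t z : bmfun u -> bmfun (fun w : R => u (z * sin t + w * cos t)).
Proof.
by move=> bu; apply: (bmfun_comp _ bu); apply: measurable_funD => //; exact: measurable_funM.
Qed.

Let avg_integrable u t z : bmfun u ->
  g1.-integrable setT (EFin \o (fun w : R => u (z * sin t + w * cos t))).
Proof. by move=> bu; apply: bmfun_integrable; exact: bmfun_lin. Qed.

Lemma avg_bnd u : bmfun u -> bnd (fun p : R * R => avg u p.1 p.2).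
Proof.
move=> bu; have [mu_ [C uC]] := bu; exists C => -[t z]/=.
apply: le_trans (le_normr_Rintegral measurableT (avg_integrable t z bu)) _.
apply: (@le_trans _ _ (\int[g1]_w (cst C) w)); last first.
  by rewrite Rintegral_cst//= probability_setT mulr1.
apply: le_Rintegral => //.
- apply: bmfun_integrable; split.
    by apply: measurableT_comp => //; exact: (bmfun_lin t z bu).1.
  by exists C => w; rewrite normr_id.
by apply: bmfun_integrable; exact: bmfun_cst.
Qed.

Lemma avg_ge u c t z : bmfun u -> (forall x, c <= u x) -> c <= avg u t z.
Proof.
move=> bu cu; apply: (@le_trans _ _ (\int[g1]_w (cst c) w)).
  by rewrite Rintegral_cst//= probability_setT mulr1.
apply: le_Rintegral => //; first by apply: bmfun_integrable; exact: bmfun_cst.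
exact: avg_integrable.
Qed.

Lemma avg0 u z : avg u 0 z = \int[g1]_w u w.
Proof. by rewrite /avg sin0 cos0; apply: eq_Rintegral => w _; rewrite mulr0 add0r mulr1. Qed.

Lemma avg_pihalf u z : avg u (pi / 2) z = u z.
Proof.
transitivity (\int[g1]_w (cst (u z)) w).
  rewrite /avg sin_pihalf cos_pihalf.
  by apply: eq_Rintegral => w _; rewrite mulr0 addr0 mulr1.
by rewrite Rintegral_cst//= probability_setT mulr1.
Qed.

Lemma is_derive_avg u u' t z : bder u u' -> bmfun u' ->
  is_derive z 1 (avg u t) (sin t * avg u' t z).
Proof.
move=> ud bu'; have [du _] := ud; have bu := bder_bmfun ud; have [_ [C u'C]] := bu'.
rewrite -RintegralZl//; last exact: avg_integrable.
apply: (is_derive_under_integral (mu := g1) (G := cst C)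
  (f := fun (x w : R) => u (x * sin t + w * cos t))
  (f' := fun (x w : R) => sin t * u' (x * sin t + w * cos t))).
- by move=> x; exact: avg_integrable.
- move=> x w.
  have d1 := is_derive_lamM (is_derive_id x 1) (is_derive_cst (sin t) x 1).
  have d2 := is_derive_lamD d1 (is_derive_cst (w * cos t) x 1).
  apply: (is_derive_eq (is_derive_lam_comp (du _) d2)).
  by rewrite /=; ring.
- by apply: bmfun_integrable; exact: bmfun_cst.
- move=> x w /=; rewrite normrM -[leRHS]mul1r ler_pM//.
  by rewrite ler_norml sin_geN1 sin_le1.
Qed.

(** Differentiation under the integral produces [u' * (z cos t - w sin t)]. Integration by parts in
    [w] trades the unbounded factor [w] for one more derivative of [u]. *)
Lemma is_derive_avg_angle u u' u'' t z : bder u u' -> bder u' u'' ->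
  continuous u'' -> bnd u'' ->
  is_derive t 1 (fun t => avg u t z)
    (cos t * (z * avg u' t z - sin t * avg u'' t z)).
Proof.
move=> ud u'd cu'' bu''; have [du _] := ud; have bu := bder_bmfun ud.
have bu' := bder_bmfun u'd; have [_ [C u'C]] := bu'.
have bmu'' : bmfun u'' by split => //; exact: continuous_measurable_fun.
have C0 : 0 <= C by rewrite (le_trans _ (u'C 0)).
have iid := @integrable_stdnormal_id R.
have iu' := avg_integrable t z bu'.
have iwu' : g1.-integrable setT (EFin \o (fun w : R => w * u' (z * sin t + w * cos t))).
  apply: (@le_integrable _ _ _ g1 setT measurableT _ (fun x => C%:E * x%:E)%E).
  - apply/measurable_EFinP/measurable_funM => //; exact: (bmfun_lin t z bu').1.
  - by move=> x _; rewrite /= lee_fin !normrM mulrC ler_wpM2r// (le_trans (u'C _))// ler_norm.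
  - by apply: integrableZl => //.
have [C'' u''C] := bu''.
have ibp : \int[g1]_w (w * u' (z * sin t + w * cos t)) = cos t * avg u'' t z.
  rewrite -RintegralZl//; last exact: avg_integrable.
  apply: (@gauss_ibp _ (fun w : R => u' (z * sin t + w * cos t))
    (fun w : R => cos t * u'' (z * sin t + w * cos t)) (C + C'')).
  - move=> w.
    have d1 := is_derive_lamM (is_derive_id w 1) (is_derive_cst (cos t) w 1).
    have d2 := is_derive_lamD (is_derive_cst (z * sin t) w 1) d1.
    have [du' _] := u'd.
    apply: (is_derive_eq (is_derive_lam_comp (du' _) d2)).
    by rewrite /=; ring.
  - move=> w; apply: cvgM; first exact: cvg_cst.
    apply: (cvg_comp (fun w : R => z * sin t + w * cos t) u''); last exact: cu''.
    by apply: cvgD; [exact: cvg_cst|apply: cvgM; [exact: cvg_id|exact: cvg_cst]].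
  - by move=> w; rewrite (le_trans (u'C _))// lerDl (le_trans _ (u''C 0)).
  - move=> w; rewrite normrM (@le_trans _ _ (1 * C''))//.
      by rewrite ler_pM// ler_norml cos_geN1 cos_le1.
    by rewrite mul1r lerDr.
have -> : cos t * (z * avg u' t z - sin t * avg u'' t z) =
  \int[g1]_w (u' (z * sin t + w * cos t) * (z * cos t - w * sin t)).
  transitivity (z * cos t * avg u' t z - sin t * (cos t * avg u'' t z)); first by ring.
  rewrite -ibp /avg -!RintegralZl// -RintegralB//.
  - by apply: eq_Rintegral => w _; ring.
  - by rewrite /comp; under eq_fun do rewrite EFinM; exact: integrableZl.
  - by rewrite /comp; under eq_fun do rewrite EFinM; exact: integrableZl.
apply: (is_derive_under_integral (mu := g1) (G := fun w : R => C * (`|z| + `|w|))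
  (f' := fun (t w : R) => u' (z * sin t + w * cos t) * (z * cos t - w * sin t))
  (f := fun (t w : R) => u (z * sin t + w * cos t))).
- by move=> x; exact: avg_integrable.
- move=> x w.
  have d1 := is_derive_lamZ z (is_derive_sin x).
  have d2 := is_derive_lamD d1 (is_derive_lamZ w (is_derive_cos x)).
  apply: (is_derive_eq (is_derive_lam_comp (du _) d2)).
  by rewrite mulrN.
- rewrite /comp; under eq_fun do rewrite EFinM EFinD.
  apply: integrableZl => //; apply: integrableD => //.
    by apply: bmfun_integrable; exact: bmfun_cst.
  by have := integrable_abse iid.
- move=> x w /=; rewrite normrM ler_pM// (le_trans (ler_normB _ _))// !normrM.
  rewrite lerD// -[leRHS]mulr1 ler_pM//.
    by rewrite ler_norml cos_geN1 cos_le1.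
  by rewrite ler_norml sin_geN1 sin_le1.
Qed.

End heat.

(** * The function [M] and its first two directional derivatives *)

Section mfun.
Context {R : realType}.
Implicit Types a b c x : R.

Definition qfun a b c := (b * b + c * c) / (2 * (a * a)).

Definition mfun a b c := ln a + Phi (qfun a b c).

(** With [v = (b, c) / a], [qfun] is [|v|^2 / 2] and this is the inner product of [v] and [v']. *)
Definition dqfun a b c a' b' c' :=
  (b * b' + c * c') / (a * a) - 2 * qfun a b c * (a' / a).

Definition dmfun a b c a' b' c' :=
  a' / a + Phi' (qfun a b c) * dqfun a b c a' b' c'.

(** The Hessian of [mfun] as a quadratic form. Along a straight line in [(a, b, c)] one has
    [v'' = - 2 (a' / a) v'], hence [q'' = |v'|^2 - 2 (a' / a) q']. *)
Definition d2mfun a b c a' b' c' :=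
  - (a' / a) ^+ 2 +
  Phi' (qfun a b c) * ((b' / a - b / a * (a' / a)) ^+ 2 +
    (c' / a - c / a * (a' / a)) ^+ 2 - 2 * (a' / a) * dqfun a b c a' b' c') +
  Phi'' (qfun a b c) * dqfun a b c a' b' c' ^+ 2.

Lemma qfun_ge0 a b c : 0 <= qfun a b c.
Proof.
by apply: divr_ge0; [rewrite addr_ge0|rewrite mulr_ge0]; rewrite // -expr2 sqr_ge0.
Qed.

Lemma is_derive_qfun (a b c : R -> R) (x a' b' c' : R) : 0 < a x ->
  is_derive x 1 a a' -> is_derive x 1 b b' -> is_derive x 1 c c' ->
  is_derive x 1 (fun t => qfun (a t) (b t) (c t))
    (dqfun (a x) (b x) (c x) a' b' c').
Proof.
move=> a0 da db dc.
have d1 := is_derive_lamD (is_derive_lamM db db) (is_derive_lamM dc dc).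
have an0 : a x != 0 by rewrite gt_eqF.
have n0 : 2 * (a x * a x) != 0 by rewrite !mulf_neq0.
have d2 := @is_derive_lamV _ (fun t => 2 * (a t * a t)) _ _ n0
  (is_derive_lamZ 2 (is_derive_lamM da da)).
apply: (is_derive_eq (is_derive_lamM d1 d2)).
by rewrite /dqfun /qfun; field.
Qed.

Lemma is_derive_mfun (a b c : R -> R) (x a' b' c' : R) : 0 < a x ->
  is_derive x 1 a a' -> is_derive x 1 b b' -> is_derive x 1 c c' ->
  is_derive x 1 (fun t => mfun (a t) (b t) (c t))
    (dmfun (a x) (b x) (c x) a' b' c').
Proof.
move=> a0 da db dc.
have dl := is_derive_lam_comp (is_derive1_ln a0) da.
have dP := @is_derive_lam_comp _ (@Phi R) (fun t => qfun (a t) (b t) (c t)) _ _ _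
  (is_derive_Phi (qfun_ge0 (a x) (b x) (c x)))
  (is_derive_qfun a0 da db dc).
apply: (is_derive_eq (is_derive_lamD dl dP)).
by rewrite /dmfun [a' / _]mulrC.
Qed.

(** Every derivative in [z] of an average brings out [s = sin t]. With that factor removed from
    [a1], [b1], [c1], the moving direction gives the first-order term and the moving point the
    Hessian term. *)
Lemma is_derive_dmfun (a b c a1 b1 c1 : R -> R) (x s a2 b2 c2 : R) : 0 < a x ->
  is_derive x 1 a (s * a1 x) -> is_derive x 1 b (s * b1 x) ->
  is_derive x 1 c (s * c1 x) ->
  is_derive x 1 a1 (s * a2) -> is_derive x 1 b1 (s * b2) ->
  is_derive x 1 c1 (s * c2) ->
  is_derive x 1 (fun t => dmfun (a t) (b t) (c t) (a1 t) (b1 t) (c1 t))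
    (s * (dmfun (a x) (b x) (c x) a2 b2 c2 +
          d2mfun (a x) (b x) (c x) (a1 x) (b1 x) (c1 x))).
Proof.
move=> a0 da db dc da1 db1 dc1.
have an0 : a x != 0 by rewrite gt_eqF.
have n0 : a x * a x != 0 by rewrite !mulf_neq0.
have dq := is_derive_qfun a0 da db dc.
have dP := @is_derive_lam_comp _ (@Phi' R) (fun t => qfun (a t) (b t) (c t)) _ _ _
  (is_derive_Phi' (qfun_ge0 (a x) (b x) (c x))) dq.
have dk := is_derive_lamM da1 (is_derive_lamV an0 da).
have d1 := is_derive_lamM
  (is_derive_lamD (is_derive_lamM db db1) (is_derive_lamM dc dc1))
  (@is_derive_lamV _ (fun t => a t * a t) _ _ n0 (is_derive_lamM da da)).
have d2 := is_derive_lamB d1 (is_derive_lamM (is_derive_lamZ 2 dq) dk).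
apply: (is_derive_eq (is_derive_lamD dk (is_derive_lamM dP d2))).
rewrite /dmfun /d2mfun; set p := Phi' _; set p' := Phi'' _.
by rewrite /dqfun /qfun; field.
Qed.

(** The Hessian alone can be negative: at [b = c = b' = c' = 0] it is [- (k / a) ^+ 2]. The added
    term turns this coefficient [-1] into [Phi' - 1], which is the form treated in
    [Phi_form_ge0]. *)
Lemma d2mfun_ge0 a b c k b' c' s : 0 < a -> 0 <= s ->
  0 <= s * d2mfun a b c k b' c' + s * Phi' (qfun a b c) * (k / a) ^+ 2.
Proof.
move=> a0 s0; have an0 : a != 0 by rewrite gt_eqF.
pose D := (b' / a - b / a * (k / a)) ^+ 2 + (c' / a - c / a * (k / a)) ^+ 2.
have D0 : 0 <= D by rewrite addr_ge0 ?sqr_ge0.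
have CS : dqfun a b c k b' c' ^+ 2 <= 2 * qfun a b c * D.
  have -> : dqfun a b c k b' c' = (b / a) * (b' / a - b / a * (k / a)) +
     (c / a) * (c' / a - c / a * (k / a)) by rewrite /dqfun /qfun; field.
  have -> : 2 * qfun a b c = (b / a) ^+ 2 + (c / a) ^+ 2.
    by rewrite /qfun; field.
  rewrite /D; set x := b / a; set y := c / a; set u := _ - _; set v := _ - _.
  (* Lagrange's identity in the plane. *)
  rewrite -subr_ge0 (_ : _ - _ = (x * v - y * u) ^+ 2); last by ring.
  exact: sqr_ge0.
have := Phi_form_ge0 (k / a) (qfun_ge0 a b c) D0 CS.
move=> h; rewrite -[s * Phi' _ * _]mulrA -mulrDr; apply: mulr_ge0 => //.
by apply: le_trans h _; rewrite le_eqVlt; apply/predU1P; left; rewrite /d2mfun /D; ring.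
Qed.

End mfun.

(** * Boundedness and continuity of [M] and its derivatives *)

Section bnd_mfun.
Context {R : realType} {T : Type}.
Variables (a b c : T -> R) (a0 : R).
Hypotheses (a0_gt0 : 0 < a0) (a0a : forall x, a0 <= a x).
Hypotheses (ba : bnd a) (bb : bnd b) (bc : bnd c).

Let bVaa : bnd (fun x => (a x * a x)^-1).
Proof.
apply: (@bndV _ _ _ (a0 * a0)); first exact: mulr_gt0.
by move=> x; rewrite ler_pM// ltW.
Qed.

Lemma bnd_qfun : bnd (fun x => qfun (a x) (b x) (c x)).
Proof.
have -> : (fun x => qfun (a x) (b x) (c x)) =
  fun x => (b x * b x + c x * c x) * (2^-1 * (a x * a x)^-1).
  by apply/funext => x; rewrite /qfun invfM.
apply: bndM; first by apply: bndD; exact: bndM.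
by apply: bndM; [exact: bnd_cst|exact: bVaa].
Qed.

Lemma bnd_mfun : bnd (fun x => mfun (a x) (b x) (c x)).
Proof.
apply: bndD; first exact: (bnd_ln a0_gt0 a0a ba).
by apply: bnd_Phi bnd_qfun => x; exact: qfun_ge0.
Qed.

Variables (a' b' c' : T -> R).
Hypotheses (ba' : bnd a') (bb' : bnd b') (bc' : bnd c').

Let bk : bnd (fun x => a' x / a x).
Proof. by apply: bndM => //; exact: (bndV a0_gt0 a0a). Qed.

Lemma bnd_dqfun :
  bnd (fun x => dqfun (a x) (b x) (c x) (a' x) (b' x) (c' x)).
Proof.
apply: bndB.
  by apply: bndM => //; apply: bndD; exact: bndM.
apply: bndM => //; apply: bndM; [exact: bnd_cst|exact: bnd_qfun].
Qed.

Lemma bnd_dmfun :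
  bnd (fun x => dmfun (a x) (b x) (c x) (a' x) (b' x) (c' x)).
Proof.
apply: bndD => //; apply: bndM; last exact: bnd_dqfun.
by apply: bnd_Phi' bnd_qfun => x; exact: qfun_ge0.
Qed.

Lemma bnd_d2mfun :
  bnd (fun x => d2mfun (a x) (b x) (c x) (a' x) (b' x) (c' x)).
Proof.
have bV : bnd (fun x => (a x)^-1) by exact: (bndV a0_gt0 a0a).
have bd := bnd_dqfun; have q0 x := qfun_ge0 (a x) (b x) (c x).
have bsq (f : T -> R) : bnd f -> bnd (fun x => f x ^+ 2).
  by move=> bf; under [X in bnd X]eq_fun do rewrite expr2; exact: bndM.
apply: bndD; last by apply: bndM; [exact: bnd_Phi'' bnd_qfun|exact: bsq].
apply: bndD; first by apply: bndN; exact: bsq.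
apply: bndM; first exact: bnd_Phi' bnd_qfun.
apply: bndB.
  by apply: bndD; apply: bsq; apply: bndB; do ?[apply: bndM => //].
by apply: bndM => //; apply: bndM => //; exact: bnd_cst.
Qed.

End bnd_mfun.

Section cont_mfun.
Context {R : realType}.

Lemma is_derive_cont (f : R -> R) (x df : R) :
  is_derive x 1 f df -> {for x, continuous f}.
Proof. by move=> fd; apply/differentiable_continuous/derivable1_diffP; have [] := fd. Qed.

Lemma continuous_Phi'' (q : R) : 0 <= q -> {for q, continuous (@Phi'' R)}.
Proof.
move=> q0; have q1 : 0 < 1 + q by rewrite ltr_wpDr.
have n1 : 1 + q != 0 by rewrite gt_eqF.
have n2 : 2 * (1 + q) != 0 by rewrite mulf_neq0.
have n3 : 2 * ((1 + q) ^+ 2) != 0 by rewrite mulf_neq0// expf_neq0.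
have d1 := is_derive_lamD (is_derive_cst (1 : R) q 1) (is_derive_id q 1).
have d2 := @is_derive_lamV _ (fun t => 2 * (1 + t)) _ _ n2 (is_derive_lamZ 2 d1).
have d3 := @is_derive_lamX _ (fun t => 1 - (2 * (1 + t))^-1) _ _ 1
  (is_derive_lamB (is_derive_cst (1 : R) q 1) d2).
have d4 := @is_derive_lamV _ (fun t => 2 * (1 + t) ^+ 2) _ _ n3
  (is_derive_lamZ 2 (@is_derive_lamX _ (fun t => 1 + t) _ _ 1 d1)).
exact: (is_derive_cont (is_derive_lamM (is_derive_Phi q0) (is_derive_lamD d3 d4))).
Qed.

Variables (a b c a' b' c' : R -> R) (x : R).
Hypotheses (a0 : 0 < a x).
Hypotheses (ca : {for x, continuous a}) (cb : {for x, continuous b})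
  (cc : {for x, continuous c}) (ca' : {for x, continuous a'})
  (cb' : {for x, continuous b'}) (cc' : {for x, continuous c'}).

Let cV : {for x, continuous (fun t => (a t)^-1)}.
Proof. by apply: cvgV => //; rewrite gt_eqF. Qed.

Let cVV : {for x, continuous (fun t => (a t * a t)^-1)}.
Proof. by apply: cvgV; [rewrite gt_eqF// mulr_gt0|exact: cvgM]. Qed.

Lemma continuous_qfun : {for x, continuous (fun t => qfun (a t) (b t) (c t))}.
Proof.
apply: cvgM; first by apply: cvgD; exact: cvgM.
apply: cvgV; first by rewrite gt_eqF// !mulr_gt0.
by apply: cvgM; [exact: cvg_cst|exact: cvgM].
Qed.

Lemma continuous_dqfun :
  {for x, continuous (fun t => dqfun (a t) (b t) (c t) (a' t) (b' t) (c' t))}.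
Proof.
apply: cvgB.
  by apply: cvgM; [apply: cvgD; exact: cvgM|exact: cVV].
apply: cvgM; last exact: cvgM.
by apply: cvgM; [exact: cvg_cst|exact: continuous_qfun].
Qed.

Let cPhi' : {for x, continuous (fun t => Phi' (qfun (a t) (b t) (c t)))}.
Proof.
apply: (@continuous_comp _ _ _ (fun t => qfun (a t) (b t) (c t)) (@Phi' R)).
  exact: continuous_qfun.
exact: is_derive_cont (is_derive_Phi' (qfun_ge0 _ _ _)).
Qed.

Lemma continuous_dmfun :
  {for x, continuous (fun t => dmfun (a t) (b t) (c t) (a' t) (b' t) (c' t))}.
Proof.
apply: cvgD; first exact: cvgM.
by apply: cvgM; [exact: cPhi'|exact: continuous_dqfun].
Qed.

Lemma continuous_d2mfun :
  {for x, continuous (fun t => d2mfun (a t) (b t) (c t) (a' t) (b' t) (c' t))}.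
Proof.
have csq (f : R -> R) : {for x, continuous f} -> {for x, continuous (fun t => f t ^+ 2)}.
  by move=> cf; rewrite /prop_for /continuous_at; under eq_fun do rewrite expr2; exact: cvgM.
have ck : {for x, continuous (fun t => a' t / a t)} by exact: cvgM.
apply: cvgD; last first.
  apply: cvgM; last by apply: csq; exact: continuous_dqfun.
  apply: (@continuous_comp _ _ _ (fun t => qfun (a t) (b t) (c t)) (@Phi'' R)).
    exact: continuous_qfun.
  exact: continuous_Phi'' (qfun_ge0 _ _ _).
apply: cvgD; first by apply: cvgN; exact: csq.
apply: cvgM; first exact: cPhi'.
apply: cvgB.
  apply: cvgD; apply: csq; apply: cvgB; do ?[exact: cvgM].
    by apply: cvgM; [exact: cvgM|exact: ck].
  by apply: cvgM; [exact: cvgM|exact: ck].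
apply: cvgM; last exact: continuous_dqfun.
by apply: cvgM; [exact: cvg_cst|exact: ck].
Qed.

End cont_mfun.

(** * Monotonicity along the interpolation *)

Section flow.
Context {R : realType}.
Local Notation gam := (normal_prob (0 : R) 1).
Variables (g0 g1 g2 g3 g4 h0 h1 h2 h3 : R -> R) (c0 : R).
Hypotheses (g01 : bder g0 g1) (g12 : bder g1 g2) (g23 : bder g2 g3)
  (g34 : bder g3 g4) (bg4 : bmfun g4).
Hypotheses (h01 : bder h0 h1) (h12 : bder h1 h2) (h23 : bder h2 h3)
  (bh3 : bmfun h3).
Hypotheses (c0_gt0 : 0 < c0) (c0g0 : forall x, c0 <= g0 x).

Let bg0 := bder_bmfun g01.
Let bg1 := bder_bmfun g12.
Let bg2 := bder_bmfun g23.
Let bg3 := bder_bmfun g34.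
Let bh0 := bder_bmfun h01.
Let bh1 := bder_bmfun h12.
Let bh2 := bder_bmfun h23.

Let F t z := mfun (avg g0 t z) (avg h0 t z) (sin t * avg g1 t z).

(** The [z]-derivative of [F] without its factor [sin t], so that nothing degenerates at [t = 0]. *)
Let Q t z := dmfun (avg g0 t z) (avg h0 t z) (sin t * avg g1 t z)
  (avg g1 t z) (avg h1 t z) (sin t * avg g2 t z).

(** The highest orders occur here. The integration by parts needs this continuous in [z], and the
    continuity of [avg g3] and [avg h2] comes from bounded [g4] and [h3]; hence four derivatives of
    [g0] and three of [h0]. *)
Let Q2 t z := dmfun (avg g0 t z) (avg h0 t z) (sin t * avg g1 t z)
  (avg g2 t z) (avg h2 t z) (sin t * avg g3 t z).

(** The contribution of the explicit factor [sin t] of the last slot, apart from [cos t]. *)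
Let Q0 t z := dmfun (avg g0 t z) (avg h0 t z) (sin t * avg g1 t z)
  0 0 (avg g1 t z).

Let D2 t z := d2mfun (avg g0 t z) (avg h0 t z) (sin t * avg g1 t z)
  (avg g1 t z) (avg h1 t z) (sin t * avg g2 t z).

Let psi t := \int[gam]_z F t z.

Let avg_gt0 t z : 0 < avg g0 t z.
Proof. by apply: (lt_le_trans c0_gt0); exact: avg_ge. Qed.

Let is_derive_sin_avg u u' (t z : R) : bder u u' -> bmfun u' ->
  is_derive z 1 (fun z => sin t * avg u t z) (sin t * (sin t * avg u' t z)).
Proof. by move=> uu' bu'; apply: is_derive_lamZ; exact: is_derive_avg. Qed.

Let F_z (t z : R) : is_derive z 1 (F t) (sin t * Q t z).
Proof.
apply: (is_derive_eq (@is_derive_mfun R _ _ _ z _ _ _ (avg_gt0 t z) (is_derive_avg t z g01 bg1)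
  (is_derive_avg t z h01 bh1) (is_derive_sin_avg t z g12 bg2))).
have := avg_gt0 t z => /lt0r_neq0 n0.
by rewrite /Q /dmfun /dqfun; field.
Qed.

Let Q_z (t z : R) : is_derive z 1 (Q t) (sin t * (Q2 t z + D2 t z)).
Proof.
apply: (@is_derive_dmfun R (avg g0 t) (avg h0 t) (fun z => sin t * avg g1 t z)
  (avg g1 t) (avg h1 t) (fun z => sin t * avg g2 t z)).
- exact: avg_gt0.
- exact: is_derive_avg.
- exact: is_derive_avg.
- exact: is_derive_sin_avg.
- exact: is_derive_avg.
- exact: is_derive_avg.
- exact: is_derive_sin_avg.
Qed.

Let F_t (t z : R) :
  is_derive t 1 (F ^~ z) (cos t * (z * Q t z - sin t * Q2 t z + Q0 t z)).
Proof.
have dc := is_derive_lamM (is_derive_sin t)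
  (is_derive_avg_angle t z g12 g23 (bder_cont g34) bg3.2).
have da := is_derive_avg_angle t z g01 g12 (bder_cont g23) bg2.2.
have db := is_derive_avg_angle t z h01 h12 (bder_cont h23) bh2.2.
apply: (is_derive_eq (@is_derive_mfun R _ _ _ t _ _ _ (avg_gt0 t z) da db dc)).
have := avg_gt0 t z => /lt0r_neq0 n0.
by rewrite /Q /Q2 /Q0 /dmfun /dqfun; field.
Qed.

Let bnd_sin_avg u : bmfun u -> bnd (fun p : R * R => sin p.1 * avg u p.1 p.2).
Proof.
move=> bu; apply: bndM; last exact: avg_bnd.
by exists 1 => p; rewrite ler_norml sin_geN1 sin_le1.
Qed.

Let c0_avg (p : R * R) : c0 <= avg g0 p.1 p.2.
Proof. exact: avg_ge. Qed.

Let bnd_F : bnd (fun p : R * R => F p.1 p.2).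
Proof.
apply: (bnd_mfun c0_gt0 c0_avg); [exact: avg_bnd|exact: avg_bnd|exact: bnd_sin_avg].
Qed.

Let bnd_Q : bnd (fun p : R * R => Q p.1 p.2).
Proof.
apply: (bnd_dmfun c0_gt0 c0_avg); do ?[exact: avg_bnd|exact: bnd_sin_avg].
Qed.

Let bnd_Q2 : bnd (fun p : R * R => Q2 p.1 p.2).
Proof.
apply: (bnd_dmfun c0_gt0 c0_avg); do ?[exact: avg_bnd|exact: bnd_sin_avg].
Qed.

Let bnd_Q0 : bnd (fun p : R * R => Q0 p.1 p.2).
Proof.
apply: (bnd_dmfun c0_gt0 c0_avg); do ?[exact: avg_bnd|exact: bnd_sin_avg|exact: bnd_cst].
Qed.

Let bnd_D2 : bnd (fun p : R * R => D2 p.1 p.2).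
Proof.
apply: (bnd_d2mfun c0_gt0 c0_avg); do ?[exact: avg_bnd|exact: bnd_sin_avg].
Qed.

Let bnd_slice (f : R -> R -> R) t : bnd (fun p : R * R => f p.1 p.2) -> bnd (f t).
Proof. by move=> [C fC]; exists C => z; exact: (fC (t, z)). Qed.

Let cont_avg u u' (t z : R) : bder u u' -> bmfun u' -> {for z, continuous (avg u t)}.
Proof. by move=> ud bu'; exact: is_derive_cont (is_derive_avg t z ud bu'). Qed.

Let cont_sin_avg u u' (t z : R) : bder u u' -> bmfun u' ->
  {for z, continuous (fun z => sin t * avg u t z)}.
Proof. by move=> ud bu'; exact: is_derive_cont (is_derive_sin_avg t z ud bu'). Qed.

Let cont_Q t : continuous (Q t).
Proof. by move=> z; exact: is_derive_cont (Q_z t z). Qed.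

Let cont_Q2 t : continuous (Q2 t).
Proof.
move=> z; apply: continuous_dmfun.
- exact: avg_gt0.
- exact: cont_avg g01 bg1.
- exact: cont_avg h01 bh1.
- exact: cont_sin_avg g12 bg2.
- exact: cont_avg g23 bg3.
- exact: cont_avg h23 bh3.
- exact: cont_sin_avg g34 bg4.
Qed.

Let cont_Q0 t : continuous (Q0 t).
Proof.
move=> z; apply: (@continuous_dmfun _ (avg g0 t) (avg h0 t)
  (fun z => sin t * avg g1 t z) (fun=> 0) (fun=> 0) (avg g1 t)).
- exact: avg_gt0.
- exact: cont_avg g01 bg1.
- exact: cont_avg h01 bh1.
- exact: cont_sin_avg g12 bg2.
- exact: cvg_cst.
- exact: cvg_cst.
- exact: cont_avg g12 bg2.
Qed.

Let cont_D2 t : continuous (D2 t).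
Proof.
move=> z; apply: continuous_d2mfun.
- exact: avg_gt0.
- exact: cont_avg g01 bg1.
- exact: cont_avg h01 bh1.
- exact: cont_sin_avg g12 bg2.
- exact: cont_avg g12 bg2.
- exact: cont_avg h12 bh2.
- exact: cont_sin_avg g23 bg3.
Qed.

Let bmfun_cont (f : R -> R -> R) t : continuous (f t) ->
  bnd (fun p : R * R => f p.1 p.2) -> bmfun (f t).
Proof.
by move=> cf bf; split; [exact: continuous_measurable_fun|exact: bnd_slice].
Qed.

Let iF t : gam.-integrable setT (EFin \o F t).
Proof.
apply: bmfun_integrable; apply: bmfun_cont => //.
by move=> z; exact: is_derive_cont (F_z t z).
Qed.

Let iQ t : gam.-integrable setT (EFin \o (fun z => z * Q t z)).
Proof.
have [C QC] := bnd_slice t bnd_Q.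
apply: (@le_integrable _ _ _ gam setT measurableT _ (fun x => C%:E * x%:E)%E).
- apply/measurable_EFinP/measurable_funM => //.
  exact: continuous_measurable_fun.
- move=> x _; rewrite /= lee_fin !normrM mulrC ler_wpM2r//.
  by rewrite (le_trans (QC x))// ler_norm.
- by apply: integrableZl => //; exact: integrable_stdnormal_id.
Qed.

(** Integration by parts turns the integral of [z * Q] into that of [sin t * (Q2 + D2)]. The [Q2]
    terms cancel, and the Hessian and the effect of the explicit [sin t] remain. *)
Let psi_t (t : R) : is_derive t 1 psi
  (cos t * \int[gam]_z (sin t * D2 t z + Q0 t z)).
Proof.
have [CQ hQ] := bnd_Q; have [C2 h2'] := bnd_Q2; have [C0 h0'] := bnd_Q0.
have C0_ge0 : 0 <= C0 by rewrite (le_trans _ (h0' (0, 0))).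
have C2_ge0 : 0 <= C2 by rewrite (le_trans _ (h2' (0, 0))).
have CQ_ge0 : 0 <= CQ by rewrite (le_trans _ (hQ (0, 0))).
have := @is_derive_under_integral R _ _ gam F
  (fun t z => cos t * (z * Q t z - sin t * Q2 t z + Q0 t z))
  (fun z => CQ * `|z| + (C2 + C0)) t iF F_t.
have -> : \int[gam]_y (cos t * (y * Q t y - sin t * Q2 t y + Q0 t y)) =
  cos t * \int[gam]_z (sin t * D2 t z + Q0 t z).
  have iR : gam.-integrable setT (EFin \o (fun z => Q0 t z - sin t * Q2 t z)).
    apply: bmfun_integrable; split.
      apply: measurable_funB; first exact: continuous_measurable_fun.
      by apply: measurable_funM => //; exact: continuous_measurable_fun.
    by apply: bndB; [exact: bnd_slice|apply: bndM; [exact: bnd_cst|exact: bnd_slice]].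
  have iS : gam.-integrable setT (EFin \o (fun z => sin t * (Q2 t z + D2 t z))).
    apply: bmfun_integrable; split.
      apply: measurable_funM => //; apply: measurable_funD; exact: continuous_measurable_fun.
    by apply: bndM; [exact: bnd_cst|apply: bndD; exact: bnd_slice].
  have ibp : \int[gam]_z (z * Q t z) = \int[gam]_z (sin t * (Q2 t z + D2 t z)).
    have [C1 hC1] := bnd_slice t bnd_Q.
    have [C3 hC3] : bnd (fun z => sin t * (Q2 t z + D2 t z)).
      by apply: bndM; [exact: bnd_cst|apply: bndD; exact: bnd_slice].
    apply: (@gauss_ibp R _ _ (C1 + C3)).
    - by move=> x; exact: Q_z.
    - move=> x; apply: cvgM; first exact: cvg_cst.
      by apply: cvgD; [exact: cont_Q2|exact: cont_D2].
    - by move=> x; rewrite (le_trans (hC1 x))// lerDl (le_trans _ (hC3 0)).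
    - by move=> x; rewrite (le_trans (hC3 x))// lerDr (le_trans _ (hC1 0)).
  transitivity (cos t * \int[gam]_z (z * Q t z + (Q0 t z - sin t * Q2 t z))).
    rewrite -RintegralZl//; last first.
      by rewrite /comp; under eq_fun do rewrite EFinD; exact: (integrableD measurableT (iQ t) iR).
    by apply: eq_Rintegral => z _; ring.
  rewrite RintegralD// ibp -RintegralD//; congr (_ * _).
  by apply: eq_Rintegral => z _; ring.
apply.
- rewrite /comp; under eq_fun do rewrite EFinD EFinM.
  apply: integrableD => //.
    apply: integrableZl => //.
    by have := integrable_abse (@integrable_stdnormal_id R).
  by apply: bmfun_integrable; exact: bmfun_cst.
- move=> x z; rewrite normrM (@le_trans _ _ (1 * (CQ * `|z| + (C2 + C0))))//; last by rewrite mul1r.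
  rewrite ler_pM//; first by rewrite ler_norml cos_geN1 cos_le1.
  rewrite [leRHS]addrA; apply: le_trans (ler_normD _ (Q0 x z)) _.
  apply: lerD; last exact: (h0' (x, z)).
  apply: le_trans (ler_normB _ _) _; apply: lerD.
    by rewrite normrM mulrC; apply: ler_wpM2r => //; exact: (hQ (x, z)).
  rewrite normrM -[leRHS]mul1r; apply: ler_pM => //; last exact: (h2' (x, z)).
  by rewrite ler_norml sin_geN1 sin_le1.
Qed.

Theorem gauss1_functional :
  ln (\int[gam]_x g0 x) + Phi ((\int[gam]_x h0 x) ^+ 2 / (2 * (\int[gam]_x g0 x) ^+ 2)) <=
  \int[gam]_x (ln (g0 x) + Phi ((h0 x ^+ 2 + g1 x ^+ 2) / (2 * g0 x ^+ 2))).
Proof.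
have -> : ln (\int[gam]_x g0 x) + Phi ((\int[gam]_x h0 x) ^+ 2 / (2 * (\int[gam]_x g0 x) ^+ 2))
  = psi 0.
  (* At [t = 0] the averages are means, so the integrand is constant, and the last slot vanishes
     with [sin 0]. *)
  rewrite /psi (_ : F 0 = cst (mfun (\int[gam]_x g0 x) (\int[gam]_x h0 x) 0)).
    rewrite Rintegral_cst//= probability_setT mulr1.
    by rewrite /mfun /qfun mulr0 addr0 -!expr2.
  by apply/funext => z; rewrite /F !avg0 sin0 mul0r.
have -> : \int[gam]_x (ln (g0 x) + Phi ((h0 x ^+ 2 + g1 x ^+ 2) / (2 * g0 x ^+ 2)))
  = psi (pi / 2).
  apply: eq_Rintegral => z _.
  by rewrite /F !avg_pihalf sin_pihalf mul1r /mfun /qfun -!expr2.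
have pi2 : 0 <= pi / 2 :> R by rewrite divr_ge0// pi_ge0.
apply: (ger0_derive1_ndecr (a := 0) (b := pi / 2) _ _ _ (lexx _) pi2 (lexx _)).
- by move=> t _; have [] := psi_t t.
- move=> t; rewrite in_itv/= => /andP[t0 tpi].
  rewrite derive1E; have ? := psi_t t; rewrite derive_val.
  have pi0 := pi_gt0 R.
  apply: mulr_ge0; first by apply: cos_ge0_pihalf; apply/andP; split; lra.
  apply: Rintegral_ge0 => z _.
  have := d2mfun_ge0 (avg h0 t z) (sin t * avg g1 t z) (avg g1 t z) (avg h1 t z)
    (sin t * avg g2 t z) (avg_gt0 t z) (sin_ge0_pi _).
  (* One factor [sin t] survives from the last slot itself, so this is exactly the term that
     [d2mfun_ge0] adds to the Hessian. *)
  have -> : Q0 t z = sin t * Phi' (qfun (avg g0 t z) (avg h0 t z) (sin t * avg g1 t z)) *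
      (avg g1 t z / avg g0 t z) ^+ 2.
    have := avg_gt0 t z => /lt0r_neq0 n0.
    by rewrite /Q0 /dmfun /dqfun; field.
  by apply; apply/andP; split; lra.
- by apply: derivable_within_continuous => t _; have [] := psi_t t.
Qed.

End flow.

(** * Tensorization *)

Section gaussian_product.
Context {R : realType}.
Local Notation mu := (@lebesgue_measure R).
Local Notation gam := (normal_prob (0 : R) 1).

Lemma sqr_enorm n (v : 'rV[R]_n) : enorm v ^+ 2 = \sum_(i < n) v ord0 i ^+ 2.
Proof. by rewrite sqr_sqrtr// sumr_ge0// => i _; exact: sqr_ge0. Qed.

Lemma cons_rV0 n (p : R * borel_rV R n) : (cons_rV p : 'rV[R]_n.+1) ord0 ord0 = p.1.
Proof. by have /(congr1 fst) := cons_rVK p. Qed.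

Lemma cons_rVS n (p : R * borel_rV R n) (i : 'I_n) :
  (cons_rV p : 'rV[R]_n.+1) ord0 (lift ord0 i) = (p.2 : 'rV[R]_n) ord0 i.
Proof.
have -> : lift ord0 i = rshift 1 i by exact/val_inj.
by rewrite /cons_rV (row_mxEr (p.1%:M : 'rV[R]_1)).
Qed.

Lemma gaussian_pdf_cons n (p : R * borel_rV R n) :
  gaussian_pdf (cons_rV p) = normal_pdf 0 1 p.1 * gaussian_pdf p.2.
Proof.
rewrite /gaussian_pdf stdnormal_pdfE !sqr_enorm big_ord_recl cons_rV0.
under eq_bigr do rewrite cons_rVS.
rewrite [(_ + \sum_(i < n) _) / _]mulrDl opprD expRD mulrACA; congr (_ * _).
have pi2 : 0 < 2 * pi :> R by rewrite mulr_gt0// pi_gt0.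
have -> : - (n.+1%:R / 2) = - (1 / 2) + - (n%:R / 2) :> R.
  by rewrite -(natr1 n); field.
rewrite powRD; last by rewrite (gt_eqF pi2) implybT.
congr (_ * _).
rewrite powRN mul1r powR12_sqrt ?ltW//.
by rewrite /normal_peak expr1n mul1r mulr_natl.
Qed.

(** Rectangles determine a product measure. Carried back by [cons_rV], the density splits into two
    factors and Tonelli's theorem separates the integrals. *)
Lemma gaussian_rect n (A : set R) (B : set (borel_rV R n)) :
  measurable A -> measurable B ->
  (gaussian R n.+1 (uncons_rV @^-1` (A `*` B)) = gam A * gaussian R n B)%E.
Proof.
move=> mA mB; have mAB : measurable (A `*` B) by exact: measurableX.
have mC : measurable (uncons_rV @^-1` (A `*` B) : set (borel_rV R n.+1)).
  by rewrite -[X in measurable X]setTI; exact: measurable_uncons_rV.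
have mpdf : measurable_fun setT (fun x : borel_rV R n.+1 => (gaussian_pdf x)%:E).
  by apply/measurable_EFinP; exact: (@measurable_gaussian_pdf R n.+1).
have p0 m (x : borel_rV R m) : (0 <= (gaussian_pdf x)%:E)%E.
  by rewrite lee_fin gaussian_pdf_ge0.
have consE : cons_rV @^-1` (uncons_rV @^-1` (A `*` B)) = A `*` B.
  by rewrite -comp_preimage (_ : _ \o _ = id)//; apply/funext/cons_rVK.
transitivity (\int[mu \x lebesgue_rV R n]_(p in A `*` B)
    (gaussian_pdf (cons_rV p))%:E)%E.
  rewrite -[in RHS]consE.
  (* This pushforward is [lebesgue_rV R n.+1] by definition. *)
  transitivity (\int[pushforward (mu \x lebesgue_rV R n) (@cons_rV R n)]_(x in
    uncons_rV @^-1` (A `*` B)) (gaussian_pdf x)%:E)%E; first by [].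
  pose m : {measure set (measurableTypeR R * borel_rV R n) -> \bar R} := (mu \x lebesgue_rV R n)%E.
  have mphi : measurable_fun [set: measurableTypeR R * borel_rV R n]
      (@cons_rV R n) by exact: measurable_cons_rV.
  have H := @ge0_integral_pushforward _ _ _ _ R _ mphi
    m _ _ mC (measurable_funTS mpdf) (fun x _ => p0 _ x).
  exact: H.
have mn : measurable_fun setT (fun v : borel_rV R n => (gaussian_pdf v)%:E).
  by apply/measurable_EFinP; exact: (@measurable_gaussian_pdf R n).
have m1 : measurable_fun setT (fun x : R => (normal_pdf 0 1 x)%:E).
  by apply/measurable_EFinP; exact: measurable_normal_pdf.
pose f1 : measurableTypeR R -> \bar R := (fun x => (normal_pdf 0 1 x)%:E) \_ A.
pose f2 : borel_rV R n -> \bar R := (fun v => (gaussian_pdf v)%:E) \_ B.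
have f10 x : (0 <= f1 x)%E.
  by apply: erestrict_ge0 => y _; rewrite lee_fin normal_pdf_ge0.
have f20 v : (0 <= f2 v)%E by apply: erestrict_ge0 => y _; exact: p0.
have mf1 : measurable_fun setT f1.
  by apply/(measurable_restrictT _ _).1 => //; exact: measurable_funTS.
have mf2 : measurable_fun setT f2.
  by apply/(measurable_restrictT _ _).1 => //; exact: measurable_funTS.
transitivity (\int[mu \x lebesgue_rV R n]_p (f1 p.1 * f2 p.2))%E.
  rewrite integral_mkcond; apply: eq_integral => p _.
  rewrite /f1 /f2 !patchE in_setX gaussian_pdf_cons.
  by case: (p.1 \in A); case: (p.2 \in B); rewrite /= ?mule0 ?mul0e ?EFinM.
rewrite fubini_tonelli1/=; last 2 first.
- by apply: emeasurable_funM; exact: measurableT_comp.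
- by move=> p; exact: mule_ge0.
under eq_integral do rewrite /fubini_F/= ge0_integralZl//.
rewrite ge0_integralZr//; last by apply: integral_ge0 => v _; exact: f20.
rewrite /gaussian /normal_prob [X in (_ = X * _)%E]integral_mkcond.
by rewrite [X in (_ = _ * X)%E]integral_mkcond.
Qed.

Lemma gaussian_setT n : gaussian R n setT = 1%E.
Proof.
elim: n => [|n IH].
  rewrite /gaussian /= integral_dirac//; last first.
    by apply/measurable_EFinP; exact: (@measurable_gaussian_pdf R 0).
  rewrite diracT mul1e /gaussian_pdf mul0r oppr0 powRr0 mul1r sqr_enorm big_ord0.
  by rewrite mul0r oppr0 expR0.
have -> : [set: borel_rV R n.+1] = uncons_rV @^-1` (setT `*` setT).
  by rewrite setXTT preimage_setT.
by rewrite gaussian_rect// IH mule1; exact: probability_setT.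
Qed.

End gaussian_product.

HB.instance Definition _ (R : realType) n :=
  @Measure_isProbability.Build _ _ R (@gaussian R n) (gaussian_setT n).

(** * Fubini's theorem for the Gaussian measure *)

Section gaussian_fubini.
Context {R : realType}.
Local Notation gam := (normal_prob (0 : R) 1).

Lemma gaussian_cons n (X : set (measurableTypeR R * borel_rV R n)) :
  measurable X ->
  (gam \x gaussian R n)%E X = gaussian R n.+1 (uncons_rV @^-1` X).
Proof.
move=> mX.
have munc : @measurable_fun _ _ (borel_rV R n.+1)
  (measurableTypeR R * borel_rV R n)%type setT uncons_rV.
  exact: measurable_uncons_rV.
have := @product_measure_unique _ _ _ _ R gam (gaussian R n)
  (measure_function_pushforward__canonical__measure_function_Measure
    (gaussian R n.+1) munc).
apply => // A B mA mB; exact: gaussian_rect.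
Qed.

Lemma measurable_cons_rV_l n (v : borel_rV R n) :
  measurable_fun setT (fun x : R => cons_rV (x, v)).
Proof.
apply: (measurableT_comp (@measurable_cons_rV R n)).
by apply: measurable_fun_pair.
Qed.

Lemma bmfun_cons_rV_l n (f : borel_rV R n.+1 -> R) v : bmfun f ->
  bmfun (fun x : R => f (cons_rV (x, v))).
Proof. by move=> bf; apply: bmfun_comp bf; exact: measurable_cons_rV_l. Qed.

(** The conditional expectation given all coordinates but the first. *)
Definition marginal n (f : borel_rV R n.+1 -> R) (v : borel_rV R n) : R :=
  \int[gam]_x f (cons_rV (x, v)).

Lemma bmfun_integrable_cons n (f : borel_rV R n.+1 -> R) : bmfun f ->
  (gam \x gaussian R n)%E.-integrable setT (EFin \o f \o cons_rV).
Proof.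
move=> [mf [C fC]]; apply: measurable_bounded_integrable => //.
- have H : (gam \x gaussian R n)%E setT = 1%E.
    by rewrite (gaussian_cons measurableT); exact: gaussian_setT.
  apply: (@le_lt_trans _ _ 1%E); last exact: ltry.
  by rewrite le_eqVlt; apply/predU1P; left; exact: H.
- by apply: measurableT_comp mf _; exact: measurable_cons_rV.
- exists C; split; first exact: num_real.
  by move=> y Cy x _; rewrite /= (le_trans (fC _))// ltW.
Qed.

Lemma marginal_EFin n (f : borel_rV R n.+1 -> R) : bmfun f ->
  EFin \o marginal f = fubini_G gam (EFin \o f \o cons_rV).
Proof.
move=> bf; apply/funext => v; rewrite /marginal /Rintegral /= fineK//.
apply: integrable_fin_num => //.
exact: (bmfun_integrable gam (bmfun_cons_rV_l v bf)).
Qed.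

Lemma bmfun_marginal n (f : borel_rV R n.+1 -> R) : bmfun f -> bmfun (marginal f).
Proof.
move=> bf; split.
  apply/measurable_EFinP; rewrite marginal_EFin//.
  exact: (measurable_fubini_G (bmfun_integrable_cons bf)).
have [_ [C fC]] := bf; exists C => v.
have iv := bmfun_integrable gam (bmfun_cons_rV_l v bf).
apply: le_trans (le_normr_Rintegral measurableT iv) _.
apply: (@le_trans _ _ (\int[gam]_w (cst C) w)); last first.
  by rewrite Rintegral_cst//= probability_setT mulr1.
apply: le_Rintegral => //.
  have := integrable_abse iv; by [].
by apply: bmfun_integrable; exact: bmfun_cst.
Qed.

Lemma Rintegral_gaussianS n (f : borel_rV R n.+1 -> R) : bmfun f ->
  \int[gaussian R n.+1]_x f x = \int[gaussian R n]_v marginal f v.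
Proof.
move=> bf; rewrite /Rintegral; congr fine.
have -> : (\int[gaussian R n]_v (marginal f v)%:E = \int[gaussian R n]_v
    fubini_G gam (EFin \o f \o cons_rV) v)%E.
  by rewrite -marginal_EFin.
rewrite (integral21_prod_meas1 (bmfun_integrable_cons bf)).
have munc : @measurable_fun _ _ (borel_rV R n.+1)
  (measurableTypeR R * borel_rV R n)%type setT uncons_rV.
  exact: measurable_uncons_rV.
have fE : (EFin \o f \o cons_rV) \o uncons_rV = EFin \o f.
  by apply/funext => x /=; rewrite uncons_rVK.
transitivity (\int[pushforward (gaussian R n.+1)
    (@uncons_rV R n : _ -> measurableTypeR R * borel_rV R n)]_p
    (EFin \o f \o cons_rV) p)%E.
  rewrite (integral_pushforward munc) ?preimage_setT ?fE//.
    have [mf _] := bf; apply: measurableT_comp; last exact: measurable_cons_rV.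
    exact/measurable_EFinP.
  exact: bmfun_integrable.
apply: eq_measure_integral => A mA _; exact/esym/gaussian_cons.
Qed.

End gaussian_fubini.

Section lines.
Context {R : realType} {V : normedModType R}.
Implicit Types (f : V -> R) (e a : V).

(** With [is_derive_of_line], carries one-variable rules over to directional derivatives and
    back. *)
Lemma is_derive_line f (p : R -> V) e (x : R) :
  (forall h, p (h + x) = h *: e + p x) -> derivable f (p x) e ->
  is_derive x 1 (f \o p) ('D_e f (p x)).
Proof.
move=> pE df.
have E : (fun h : R => h^-1 *: (((f \o p) \o shift x) (h *: 1) - (f \o p) x)) =
    (fun h : R => h^-1 *: ((f \o shift (p x)) (h *: e) - f (p x))).
  apply/funext => h /=; congr (_ *: (f _ - _)).
  by rewrite -pE /GRing.scale/= mulr1.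
by apply: DeriveDef; rewrite /derivable /derive E.
Qed.

Lemma is_derive_of_line f e a d :
  is_derive (0 : R) 1 (fun h : R => f (h *: e + a)) d -> is_derive a e f d.
Proof.
case=> df dE.
have E : (fun h : R => h^-1 *: (((fun h : R => f (h *: e + a)) \o shift 0) (h *: 1) -
      f (0 *: e + a))) =
    (fun h : R => h^-1 *: ((f \o shift a) (h *: e) - f a)).
  apply/funext => h /=; congr (_ *: (f _ - f _)); last by rewrite scale0r add0r.
  by rewrite /GRing.scale/= addr0 mulr1.
by move: df dE; rewrite /derivable /derive E => df dE; exact: DeriveDef.
Qed.

End lines.

(** * Functions with bounded derivatives and the induction on the dimension *)

Section bounded_smooth.
Context {R : realType}.
Local Notation gam := (normal_prob (0 : R) 1).

Lemma rV_deltaE n (h : R) (k i : 'I_n) (w : 'rV[R]_n) :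
  (h *: delta_mx ord0 k + w) ord0 i = h * (i == k)%:R + w ord0 i.
Proof. by rewrite !mxE eqxx. Qed.

Lemma cons_rV_head n (v : borel_rV R n) (h x : R) :
  (cons_rV (h + x, v) : 'rV[R]_n.+1) =
  h *: (delta_mx ord0 ord0 : 'rV[R]_n.+1) + cons_rV (x, v).
Proof.
apply/rowP => i; rewrite rV_deltaE; case: (unliftP ord0 i) => [j|] ->.
  by rewrite !cons_rVS/= mulr0 add0r.
by rewrite !cons_rV0/= mulr1.
Qed.

Lemma cons_rV_tail n (v : 'rV[R]_n) (h x : R) (j : 'I_n) :
  (cons_rV (x, h *: (delta_mx ord0 j) + v) : 'rV[R]_n.+1) =
  h *: (delta_mx ord0 (lift ord0 j) : 'rV[R]_n.+1) + cons_rV (x, v).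
Proof.
apply/rowP => i; rewrite rV_deltaE; case: (unliftP ord0 i) => [k|] ->.
  by rewrite !cons_rVS/= rV_deltaE (inj_eq lift_inj).
by rewrite !cons_rV0/= mulr0 add0r.
Qed.

(** Measurability and bounds, not continuity, are what passes to [marginal] by differentiation under
    the integral. Continuity along a line is recovered from the next derivative. *)
Fixpoint bsmooth n k (f : 'rV[R]_n -> R) : Prop :=
  bmfun (f : borel_rV R n -> R) /\
  if k is k'.+1 then forall i : 'I_n,
    (forall x, derivable f x (delta_mx ord0 i)) /\ bsmooth k' (partial i f)
  else True.

Lemma bsmooth_bmfun n k (f : 'rV[R]_n -> R) :
  bsmooth k f -> bmfun (f : borel_rV R n -> R).
Proof. by case: k => [|k] []. Qed.

Lemma bsmoothD n k (f g : 'rV[R]_n -> R) : bsmooth k f -> bsmooth k g ->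
  bsmooth k (fun x => f x + g x).
Proof.
elim: k f g => [|k IH] f g /= [bf df] [bg dg]; split => //; try exact: bmfunD.
move=> i; have [dfi pf] := df i; have [dgi pg] := dg i.
split; first by move=> x; exact: derivableD.
rewrite (_ : partial i _ = fun x => partial i f x + partial i g x); first exact: IH.
by apply/funext => x; rewrite /partial deriveD.
Qed.

Lemma bsmoothZ n k c (f : 'rV[R]_n -> R) : bsmooth k f -> bsmooth k (fun x => c * f x).
Proof.
elim: k f => [|k IH] f /= [bf df]; split => //;
  try by apply: bmfunM => //; exact: bmfun_cst.
move=> i; have [dfi pf] := df i.
split; first by move=> x; exact: derivableZ.
rewrite (_ : partial i _ = fun x => c * partial i f x); first exact: IH.
by apply/funext => x; rewrite /partial deriveZ.
Qed.

Lemma bsmooth_cst n k c : bsmooth k (fun _ : 'rV[R]_n => c).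
Proof.
elim: k c => [|k IH] c /=; split => //; try exact: bmfun_cst.
move=> i; split; first by move=> x; exact: derivable_cst.
rewrite (_ : partial i _ = fun=> 0); first exact: IH.
by apply/funext => x; rewrite /partial derive_cst.
Qed.

Lemma bsmooth_sum n k (I : Type) (r : seq I) (F : I -> 'rV[R]_n -> R) :
  (forall i, bsmooth k (F i)) -> bsmooth k (fun x => \sum_(i <- r) F i x).
Proof.
move=> bF; elim: r => [|i r IH].
  by rewrite (_ : (fun _ => _) = fun=> 0);
    [exact: bsmooth_cst|apply/funext => x; rewrite big_nil].
by rewrite (_ : (fun _ => _) = fun x => F i x + \sum_(i <- r) F i x);
  [exact: bsmoothD|apply/funext => x; rewrite big_cons].
Qed.

Lemma is_derive_cons n (f : 'rV[R]_n.+1 -> R) (v : borel_rV R n) (x : R) :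
  derivable f (cons_rV (x, v)) (delta_mx ord0 ord0) ->
  is_derive x 1 (fun x => f (cons_rV (x, v))) (partial ord0 f (cons_rV (x, v))).
Proof.
move=> df.
apply: (@is_derive_line _ _ f (fun x => cons_rV (x, v) : 'rV[R]_n.+1)) => // h.
exact: cons_rV_head.
Qed.

Lemma bder_cons n k (f : 'rV[R]_n.+1 -> R) (v : borel_rV R n) :
  bsmooth k.+1 f -> bder (fun x : R => f (cons_rV (x, v)))
    (fun x => partial ord0 f (cons_rV (x, v))).
Proof.
move=> [bf /(_ ord0)[df _]]; split; first by move=> x; exact: is_derive_cons.
by have [_ [C fC]] := bf; exists C.
Qed.

Lemma is_derive_marginal n (f : 'rV[R]_n.+1 -> R) (j : 'I_n) (v : 'rV[R]_n) :
  bmfun (f : borel_rV R n.+1 -> R) ->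
  bmfun (partial (lift ord0 j) f : borel_rV R n.+1 -> R) ->
  (forall x, derivable f x (delta_mx ord0 (lift ord0 j))) ->
  is_derive v (delta_mx ord0 j) (marginal f : 'rV[R]_n -> R)
    (marginal (partial (lift ord0 j) f) v).
Proof.
move=> bf bpf df; apply: is_derive_of_line.
have [_ [C fC]] := bpf.
have -> : marginal (partial (lift ord0 j) f) v =
  \int[gam]_x partial (lift ord0 j) f (cons_rV (x, 0 *: delta_mx ord0 j + v)).
  by rewrite scale0r add0r.
apply: (@is_derive_under_integral R _ _ gam
  (fun (h x : R) => f (cons_rV (x, h *: delta_mx ord0 j + v)))
  (fun (h x : R) => partial (lift ord0 j) f (cons_rV (x, h *: delta_mx ord0 j + v)))
  (cst C)).
- by move=> h; apply: bmfun_integrable; exact: (bmfun_cons_rV_l _ bf).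
- move=> h x; apply: (@is_derive_line _ _ f
    (fun h => cons_rV (x, h *: delta_mx ord0 j + v) : 'rV[R]_n.+1)) => // h'.
  by rewrite scalerDl -addrA cons_rV_tail.
- by apply: bmfun_integrable; exact: bmfun_cst.
- by move=> h x; exact: fC.
Qed.

Lemma partial_marginal n k (f : 'rV[R]_n.+1 -> R) (j : 'I_n) : bsmooth k.+1 f ->
  partial j (marginal f) = marginal (partial (lift ord0 j) f).
Proof.
move=> [bf /(_ (lift ord0 j))[df /bsmooth_bmfun bp]]; apply/funext => v.
by rewrite /partial; have ? := is_derive_marginal v bf bp df; rewrite derive_val.
Qed.

Lemma bsmooth_marginal n k (f : 'rV[R]_n.+1 -> R) : bsmooth k f -> bsmooth k (marginal f).
Proof.
elim: k f => [|k IH] f bfk; have bf := bsmooth_bmfun bfk; split => //;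
  try exact: bmfun_marginal.
move=> j; rewrite (partial_marginal j bfk).
have [_ /(_ (lift ord0 j))[df bp]] := bfk; split; last exact: IH.
by move=> v; have [] := is_derive_marginal v bf (bsmooth_bmfun bp) df.
Qed.

(** Cauchy-Schwarz, from the square of [d - t e]. Length less than one is allowed because the
    direction is [0] where the mean gradient vanishes. *)
Lemma sum_mul_sqr_le n (e d : 'I_n -> R) : \sum_(j < n) e j ^+ 2 <= 1 ->
  (\sum_(j < n) e j * d j) ^+ 2 <= \sum_(j < n) d j ^+ 2.
Proof.
move=> e1; set t := \sum_(j < n) e j * d j.
have tE : t = \sum_(j < n) e j * d j by [].
clearbody t.
have : 0 <= \sum_(j < n) (d j - t * e j) ^+ 2.
  by apply: sumr_ge0 => j _; exact: sqr_ge0.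
have -> : \sum_(j < n) (d j - t * e j) ^+ 2 =
  \sum_(j < n) d j ^+ 2 - 2 * t * t + t ^+ 2 * \sum_(j < n) e j ^+ 2.
  rewrite [X in _ - X](_ : _ = \sum_(j < n) 2 * t * (e j * d j)); last first.
    by rewrite -mulr_sumr -tE.
  by rewrite mulr_sumr -sumrB -big_split/=; apply: eq_bigr => j _; ring.
have := sqr_ge0 t; nra.
Qed.

Definition sqgrad n (g : 'rV[R]_n -> R) x := \sum_(i < n) partial i g x ^+ 2.

(** This is [M (g, grad g)]; for [g = e^f] it equals [f + Phi (|grad f|^2 / 2)]. *)
Definition logfun n (g : 'rV[R]_n -> R) (x : 'rV[R]_n) :=
  ln (g x) + Phi (sqgrad g x / (2 * g x ^+ 2)).

Lemma measurable_fun_invr d (T : measurableType d) (g : T -> R) :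
  (forall x, 0 < g x) -> measurable_fun setT g ->
  measurable_fun setT (fun x => (g x)^-1).
Proof.
move=> g0 mg; rewrite (_ : (fun _ => _) = fun x => expR (- ln (g x))); last first.
  by apply/funext => x; rewrite expRN lnK// posrE.
apply: measurableT_comp; first exact: measurable_expR.
apply: measurable_funN; apply: measurableT_comp => //; exact: measurable_ln.
Qed.

Lemma measurable_fun_Phi d (T : measurableType d) (g : T -> R) :
  measurable_fun setT g -> measurable_fun setT (fun x => Phi (g x)).
Proof.
move=> mg; apply: measurable_funM => //; apply: measurableT_comp; first exact: measurable_expR.
apply: measurable_funB => //.
apply: measurable_funM => //; apply: measurableT_comp; first exact: measurable_ln.
exact: measurable_funD.
Qed.

Lemma bmfun_ln_Phi d (T : measurableType d) (g s : T -> R) c : 0 < c ->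
  (forall x, c <= g x) -> (forall x, 0 <= s x) -> bmfun g -> bmfun s ->
  bmfun (fun x => ln (g x) + Phi (s x / (2 * g x ^+ 2))).
Proof.
move=> c0 cg s0 bg bs.
have bV : bmfun (fun x => (2 * g x ^+ 2)^-1).
  split; last first.
    apply: (@bndV _ _ _ (2 * c ^+ 2)); first by rewrite mulr_gt0// exprn_gt0.
    by move=> x; rewrite ler_wpM2l// lerXn2r ?nnegrE ?(le_trans (ltW c0)) ?(ltW c0).
  apply: measurable_fun_invr; last first.
    by apply: measurable_funM => //; apply: measurable_funX; exact: bg.1.
  by move=> x; rewrite mulr_gt0// exprn_gt0//; exact: lt_le_trans (cg x).
have bq : bmfun (fun x => s x / (2 * g x ^+ 2)) by exact: bmfunM.
have q0 x : 0 <= s x / (2 * g x ^+ 2).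
  by apply: divr_ge0 => //; apply: mulr_ge0 => //; exact: sqr_ge0.
apply: bmfunD; split.
- by apply: measurableT_comp; [exact: measurable_ln|exact: bg.1].
- exact: bnd_ln c0 cg bg.2.
- exact: measurable_fun_Phi bq.1.
- exact: bnd_Phi q0 bq.2.
Qed.

Lemma bmfun_sqr d (T : measurableType d) (f : T -> R) :
  bmfun f -> bmfun (fun x => f x ^+ 2).
Proof. by move=> bf; under eq_fun do rewrite expr2; exact: bmfunM. Qed.

Lemma bmfun_logfun n (g : 'rV[R]_n -> R) c : 0 < c -> (forall x, c <= g x) ->
  bsmooth 1 g -> bmfun (logfun g : borel_rV R n -> R).
Proof.
move=> c0 cg [bg dg]; apply: (bmfun_ln_Phi c0) => //.
  by move=> x; apply: sumr_ge0 => i _; exact: sqr_ge0.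
by apply: bmfun_sum => i; apply: bmfun_sqr; have [_ [+ _]] := dg i.
Qed.

Lemma Rintegral_sum d (T : measurableType d) (mu : {finite_measure set T -> \bar R})
    (I : Type) (r : seq I) (e : I -> R) (F : I -> T -> R) :
  (forall i, bmfun (F i)) ->
  \int[mu]_x (\sum_(i <- r) e i * F i x) = \sum_(i <- r) e i * \int[mu]_x F i x.
Proof.
move=> bF; have beF i : bmfun (fun x => e i * F i x).
  by apply: bmfunM => //; exact: bmfun_cst.
elim: r => [|i r IH].
  under eq_Rintegral do rewrite big_nil.
  by rewrite Rintegral_cst// mul0r big_nil.
under eq_Rintegral do rewrite big_cons.
rewrite RintegralD//; last 2 first.
- exact: bmfun_integrable.
- by apply: bmfun_integrable; exact: bmfun_sum.
by rewrite IH RintegralZl ?big_cons//; exact: bmfun_integrable.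
Qed.

Lemma bsmoothW n k (f : 'rV[R]_n -> R) : bsmooth k.+1 f -> bsmooth k f.
Proof.
elim: k f => [|k IH] f [bf df]; split => // i.
by have [dfi bi] := df i; split => //; exact: IH.
Qed.

(** The direction [e] depends on [v] but not on the integrated coordinate, so [hh] is a legitimate
    passive variable. Its mean is the full length of the gradient of the marginal, while pointwise
    it is at most the length of the remaining gradient; monotonicity of [Phi] does the rest. *)
Lemma logfun_marginal_le n (g : 'rV[R]_n.+1 -> R) c (v : 'rV[R]_n) : 0 < c ->
  (forall x, c <= g x) -> bsmooth 4 g -> logfun (marginal g) v <= marginal (logfun g) v.
Proof.
move=> c0 cg bg.
pose dg j := partial (lift ord0 j) g.
have bdg j : bsmooth 3 (dg j) by have [_ /(_ (lift ord0 j))[]] := bg.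
pose m j := marginal (dg j) v.
pose N := Num.sqrt (\sum_j m j ^+ 2).
(* The gradient's direction; it is 0 when [N = 0], because [x / 0 = 0]. *)
pose e j := m j / N.
have mm0 : 0 <= \sum_j m j ^+ 2 by apply: sumr_ge0 => j _; exact: sqr_ge0.
have NN : N ^+ 2 = \sum_j m j ^+ 2 by rewrite sqr_sqrtr.
have e1 : \sum_j e j ^+ 2 <= 1.
  under eq_bigr do rewrite exprMn.
  rewrite -mulr_suml -NN exprVn.
  by have [->|N0] := eqVneq N 0; [rewrite expr0n/= mul0r|rewrite divff// expf_neq0].
have emN : \sum_j e j * m j = N ^+ 2 / N.
  by rewrite NN mulr_suml; apply: eq_bigr => j _; rewrite /e expr2 mulrAC.
have em : (\sum_j e j * m j) ^+ 2 = N ^+ 2.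
  by rewrite emN; have [->|N0] := eqVneq N 0;
    [rewrite expr0n/= mul0r expr0n|rewrite [N ^+ 2 / N]mulrAC mulfV// mul1r].
pose hh (x : 'rV[R]_n.+1) := \sum_j e j * dg j x.
(* [hh] uses one of the four derivatives of [g]; the three left are what the passive variable
   needs. *)
have bh : bsmooth 3 hh by apply: bsmooth_sum => j; exact: bsmoothZ.
have bg1 : bsmooth 3 (partial ord0 g) by have [_ /(_ ord0)[]] := bg.
have bg2 : bsmooth 2 (partial ord0 (partial ord0 g)) by have [_ /(_ ord0)[]] := bg1.
have bg3 : bsmooth 1 (partial ord0 (partial ord0 (partial ord0 g))).
  by have [_ /(_ ord0)[]] := bg2.
have bg4 : bsmooth 0 (partial ord0 (partial ord0 (partial ord0 (partial ord0 g)))).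
  by have [_ /(_ ord0)[]] := bg3.
have bh1 : bsmooth 2 (partial ord0 hh) by have [_ /(_ ord0)[]] := bh.
have bh2 : bsmooth 1 (partial ord0 (partial ord0 hh)) by have [_ /(_ ord0)[]] := bh1.
have bh3 : bsmooth 0 (partial ord0 (partial ord0 (partial ord0 hh))).
  by have [_ /(_ ord0)[]] := bh2.
have := @gauss1_functional R _ _ _ _ _ _ _ _ _ c
  (bder_cons v bg) (bder_cons v bg1) (bder_cons v bg2) (bder_cons v bg3)
  (bmfun_cons_rV_l v (bsmooth_bmfun bg4))
  (bder_cons v bh) (bder_cons v bh1) (bder_cons v bh2)
  (bmfun_cons_rV_l v (bsmooth_bmfun bh3)) c0 (fun x => cg _).
have -> : \int[gam]_x hh (cons_rV (x, v)) = \sum_j e j * m j.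
  by apply: Rintegral_sum => j; exact: (bmfun_cons_rV_l v (bsmooth_bmfun (bdg j))).
rewrite em NN.
have -> : \sum_j m j ^+ 2 = sqgrad (marginal g) v.
  by apply: eq_bigr => j _; rewrite (partial_marginal j bg).
move=> h; apply: le_trans h _; apply: le_Rintegral => //.
- apply: (@bmfun_integrable _ _ _ gam); apply: (bmfun_ln_Phi c0) => //.
  + by move=> x; apply: addr_ge0; exact: sqr_ge0.
  + exact: (bmfun_cons_rV_l v (bsmooth_bmfun bg)).
  + apply: bmfunD; apply: bmfun_sqr.
      exact: (bmfun_cons_rV_l v (bsmooth_bmfun bh)).
    exact: (bmfun_cons_rV_l v (bsmooth_bmfun bg1)).
- apply: (@bmfun_integrable _ _ _ gam); apply: bmfun_cons_rV_l.
  by apply: (bmfun_logfun c0 cg); do 3!apply: bsmoothW.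
move=> x _; rewrite /logfun lerD2l; apply: ler_Phi.
  by apply: divr_ge0; [apply: addr_ge0|apply: mulr_ge0 => //]; exact: sqr_ge0.
apply: ler_wpM2r; first by rewrite invr_ge0; apply: mulr_ge0 => //; exact: sqr_ge0.
by rewrite /sqgrad big_ord_recl addrC lerD2l; exact: sum_mul_sqr_le.
Qed.

(** Induction through [marginal], which inherits both the lower bound and [bsmooth 4]. *)
Lemma gaussian_functional n (g : 'rV[R]_n -> R) c : 0 < c ->
  (forall x, c <= g x) -> bsmooth 4 g ->
  ln (\int[gaussian R n]_x g x) + 8 <= \int[gaussian R n]_x logfun g x.
Proof.
move=> c0; elim: n g => [|n IH] g cg bg.
  (* In dimension zero there is one point and no gradient; the claim is [8 <= Phi 0]. *)
  have gE (x : 'rV[R]_0) : x = 0 by apply/rowP => -[].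
  have -> : \int[gaussian R 0]_x g x = \int[gaussian R 0]_x (cst (g 0)) x.
    by apply: eq_Rintegral => x _; rewrite (gE x).
  have -> : \int[gaussian R 0]_x logfun g x =
      \int[gaussian R 0]_x (cst (ln (g 0) + Phi 0)) x.
    by apply: eq_Rintegral => x _; rewrite (gE x) /logfun /sqgrad big_ord0 mul0r.
  rewrite !Rintegral_cst//= probability_setT !mulr1 lerD2l; exact: Phi_ge8.
have bg1 : bsmooth 1 g by do 3!apply: bsmoothW.
have bl := bmfun_logfun c0 cg bg1.
rewrite (Rintegral_gaussianS (bsmooth_bmfun bg)) (Rintegral_gaussianS bl).
have cm v : c <= marginal g v.
  apply: (@le_trans _ _ (\int[gam]_w (cst c) w)).
    by rewrite Rintegral_cst//= probability_setT mulr1.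
  apply: le_Rintegral => //.
  - by apply: bmfun_integrable; exact: bmfun_cst.
  - apply: bmfun_integrable; exact: (bmfun_cons_rV_l v (bsmooth_bmfun bg)).
apply: le_trans (IH _ cm (bsmooth_marginal bg)) _.
apply: le_Rintegral => //.
- apply: bmfun_integrable; apply: (bmfun_logfun c0 cm).
  by apply: bsmooth_marginal.
- by apply: bmfun_integrable; exact: bmfun_marginal.
- by move=> v _; exact: logfun_marginal_le c0 cg bg.
Qed.

End bounded_smooth.

(** * Smooth functions and the approximation of f *)

Section Ck.
Context {R : realType} {n : nat}.
Implicit Types (f g : 'rV[R]_n -> R) (F : R -> R).

(** Continuity without bounds, as opposed to [bsmooth]: stable under products and compositions.
    Bounds return with compact support in [Ck_bsmooth]. *)
Fixpoint Ck k f : Prop :=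
  continuous f /\
  if k is k'.+1 then forall i : 'I_n,
    (forall x, derivable f x (delta_mx ord0 i)) /\ Ck k' (partial i f)
  else True.

Fixpoint Ck1 k F : Prop :=
  continuous F /\
  if k is k'.+1 then exists F', (forall t : R, is_derive t 1 F (F' t)) /\ Ck1 k' F'
  else True.

Lemma Ck_cont k f : Ck k f -> continuous f. Proof. by case: k => [|k] []. Qed.

Lemma CkW k f : Ck k.+1 f -> Ck k f.
Proof.
elim: k f => [|k IH] f [cf df]; split => // i.
by have [dfi ci] := df i; split => //; exact: IH.
Qed.

Lemma smooth_Ck k f : smooth f -> Ck k f.
Proof.
elim: k f => [|k IH] f sf; (split; first by have [] := sf [::]) => //.
move=> i; split; first by have [_] := sf [::]; exact.
(* The last entry of the list is differentiated first, hence [rcons]. *)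
by apply: IH => s; have := sf (rcons s i); rewrite foldr_rcons.
Qed.

Lemma Ck_cst k c : Ck k (fun=> c).
Proof.
elim: k c => [|k IH] c; (split; first exact: cst_continuous) => // i.
split; first by move=> x; exact: derivable_cst.
rewrite (_ : partial i _ = fun=> 0); first exact: IH.
by apply/funext => x; rewrite /partial derive_cst.
Qed.

Lemma CkD k f g : Ck k f -> Ck k g -> Ck k (fun x => f x + g x).
Proof.
elim: k f g => [|k IH] f g [cf df] [cg dg];
  (split; first by move=> x; exact: (cvgD (cf x) (cg x))) => // i.
have [dfi pf] := df i; have [dgi pg] := dg i.
split; first by move=> x; exact: derivableD.
rewrite (_ : partial i _ = fun x => partial i f x + partial i g x); first exact: IH.
by apply/funext => x; rewrite /partial deriveD.
Qed.

Lemma partialM f g i x : derivable f x (delta_mx ord0 i) ->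
  derivable g x (delta_mx ord0 i) ->
  partial i (fun x => f x * g x) x = f x * partial i g x + g x * partial i f x.
Proof. by move=> df dg; rewrite /partial deriveM. Qed.

Lemma CkM k f g : Ck k f -> Ck k g -> Ck k (fun x => f x * g x).
Proof.
elim: k f g => [|k IH] f g Cf Cg; have [cf df] := Cf; have [cg dg] := Cg;
  (split; first by move=> x; exact: (cvgM (cf x) (cg x))) => // i.
have [dfi pf] := df i; have [dgi pg] := dg i.
split; first by move=> x; exact: derivableM.
rewrite (_ : partial i _ = fun x => f x * partial i g x + g x * partial i f x).
  by apply: CkD; apply: IH => //; exact: CkW.
by apply/funext => x; exact: partialM.
Qed.

Lemma is_derive_compl F f (x e : 'rV[R]_n) d : is_derive (f x) 1 F d ->
  derivable f x e -> is_derive x e (F \o f) (d * 'D_e f x).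
Proof.
move=> dF df; apply: is_derive_of_line.
pose p (h : R) := h *: e + x.
have p0 : p 0 = x by rewrite /p scale0r add0r.
have dl : is_derive (0 : R) 1 (f \o p) ('D_e f x).
  rewrite -p0; apply: is_derive_line; last by rewrite p0.
  by move=> h; rewrite p0 /p addr0.
by apply: (@is_derive1_comp _ F (f \o p)) => //=; rewrite p0.
Qed.

Lemma partial_comp F F' f i x : is_derive (f x) 1 F (F' (f x)) ->
  derivable f x (delta_mx ord0 i) ->
  partial i (F \o f) x = F' (f x) * partial i f x.
Proof.
by move=> dF df; rewrite /partial; have ? := is_derive_compl dF df; rewrite derive_val.
Qed.

Lemma Ck_comp k F f : Ck1 k F -> Ck k f -> Ck k (F \o f).
Proof.
elim: k F f => [|k IH] F f CF Cf; have [cF dF] := CF; have [cf df] := Cf;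
  (split; first by move=> x; exact: (continuous_comp (cf x) (cF (f x)))) => // i.
have [F' [dF' CF']] := dF; have [dfi pf] := df i.
split; first by move=> x; have [] := is_derive_compl (dF' (f x)) (dfi x).
rewrite (_ : partial i _ = fun x => (F' \o f) x * partial i f x).
  by apply: CkM => //; apply: IH => //; exact: CkW.
by apply/funext => x; exact: partial_comp.
Qed.

Lemma is_derive_coord (x : 'rV[R]_n) (i j : 'I_n) :
  is_derive x (delta_mx ord0 i) (fun x : 'rV[R]_n => x ord0 j) (j == i)%:R.
Proof.
apply: is_derive_of_line.
rewrite (_ : (fun h : R => _) = fun h : R => h * (j == i)%:R + x ord0 j).
  have d1 := is_derive_lamM (is_derive_id (0 : R) 1) (is_derive_cst ((j == i)%:R : R) (0 : R) 1).
  apply: (is_derive_eq (is_derive_lamD d1 (is_derive_cst (x ord0 j) (0 : R) 1))).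
  by rewrite /= mul0r mul1r !addr0.
by apply/funext => h; rewrite rV_deltaE.
Qed.

Lemma Ck_coord k (j : 'I_n) : Ck k (fun x : 'rV[R]_n => x ord0 j).
Proof.
case: k => [|k]; (split; first exact: coord_continuous) => // i.
split; first by move=> x; have [] := is_derive_coord x i j.
rewrite (_ : partial i _ = fun=> (j == i)%:R); first exact: Ck_cst.
by apply/funext => x; rewrite /partial; have ? := is_derive_coord x i j; rewrite derive_val.
Qed.

Lemma Ck_sum k (I : Type) (r : seq I) (F : I -> 'rV[R]_n -> R) :
  (forall i, Ck k (F i)) -> Ck k (fun x => \sum_(i <- r) F i x).
Proof.
move=> bF; elim: r => [|i r IH].
  by rewrite (_ : (fun _ => _) = fun=> 0);
    [exact: Ck_cst|apply/funext => x; rewrite big_nil].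
by rewrite (_ : (fun _ => _) = fun x => F i x + \sum_(i <- r) F i x);
  [exact: CkD|apply/funext => x; rewrite big_cons].
Qed.

Definition sqnorm (x : 'rV[R]_n) := \sum_(j < n) x ord0 j * x ord0 j.

Lemma is_derive_sqnorm i x :
  is_derive x (delta_mx ord0 i) sqnorm (2 * x ord0 i).
Proof.
have dj (j : 'I_n) : is_derive x (delta_mx ord0 i) (fun x : 'rV[R]_n => x ord0 j * x ord0 j)
    (2 * x ord0 j * (j == i)%:R).
  have := is_deriveM (is_derive_coord x i j) (is_derive_coord x i j) => d.
  by apply: (is_derive_eq d); rewrite /GRing.scale/=; ring.
have d := is_derive_sum dj.
rewrite (_ : sqnorm = \sum_(j < n) (fun x : 'rV[R]_n => x ord0 j * x ord0 j)); last first.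
  by apply/funext => y; rewrite fct_sumE.
apply: (is_derive_eq d).
rewrite (bigD1 i)//= eqxx mulr1 big1 ?addr0// => j /negbTE ->.
by rewrite mulr0.
Qed.

(** The exterior of the ball is open, so [f] vanishes in a neighbourhood of each of its points. *)
Lemma partial_out (rho : R) f i : (forall x : 'rV[R]_n, rho < `|x| -> f x = 0) ->
  forall x : 'rV[R]_n, rho < `|x| -> partial i f x = 0.
Proof.
move=> f0 x rx; rewrite /partial.
have -> : 'D_(delta_mx ord0 i) f x = 'D_(delta_mx ord0 i) (fun=> 0) x.
  apply: near_eq_derive.
  near=> y; apply: f0; near: y.
  exact: (cvgr_gt _ (@norm_continuous _ 'rV[R]_n x)).
by rewrite derive_cst.
Unshelve. all: end_near. Qed.

Lemma continuous_rV_measurable f : continuous f ->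
  measurable_fun setT (f : borel_rV R n -> R).
Proof.
move=> cf; apply: (measurability _ (RGenOpens.measurableE R)) => _ [_ [a [b ->] <-]].
rewrite setTI; apply: open_rV_measurable.
by apply: open_comp (interval_open _ _) => // v _; exact: cf.
Qed.

Lemma bounded_on_ball (rho : R) f : continuous f ->
  exists C, forall x : 'rV[R]_n, `|x| <= rho -> `|f x| <= C.
Proof.
move=> cf; pose A := [set x : 'rV[R]_n | `|x| <= rho].
have cA : compact A.
  apply: bounded_closed_compact.
    exists rho; split; first exact: num_real.
    by move=> y ry x Ax; exact: le_trans (ltW ry).
  apply: (@closed_comp _ _ (fun x : 'rV[R]_n => `|x|) [set y | y <= rho]).
    by move=> x _; exact: norm_continuous.
  exact: closed_le.
have cfA : {within A, continuous f} by exact: continuous_subspaceT.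
have /compact_bounded[M [_ MA]] := continuous_compact cfA cA.
exists (M + 1) => x xrho; apply: (MA (M + 1)); first by rewrite ltrDl.
by exists x.
Qed.

(** Every partial derivative is continuous, hence bounded on the compact ball, and vanishes
    outside. *)
Lemma Ck_bsmooth k (rho : R) f : (forall x : 'rV[R]_n, rho < `|x| -> f x = 0) ->
  Ck k f -> bsmooth k f.
Proof.
have bf g : (forall x : 'rV[R]_n, rho < `|x| -> g x = 0) -> continuous g ->
    bmfun (g : borel_rV R n -> R).
  move=> g0 cg; split; first exact: continuous_rV_measurable.
  have [C gC] := bounded_on_ball rho cg; exists (`|C|) => x.
  have [xr|rx] := leP `|x| rho; first by rewrite (le_trans (gC _ xr))// ler_norm.
  by rewrite g0// normr0.
elim: k f => [|k IH] f f0 [cf df]; (split; first exact: bf) => // i.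
by have [dfi ci] := df i; split => //; apply: IH => //; exact: partial_out.
Qed.

End Ck.

Section Ck1_examples.
Context {R : realType}.
Implicit Types (t : R).

Lemma Ck1_expR k : Ck1 k (@expR R).
Proof.
elim: k => [|k IH]; (split; first exact: continuous_expR) => //.
by exists expR; split => // t; exact: is_derive_expR.
Qed.

Lemma Ck1_sin_cos k (a b : R) :
  Ck1 k (fun t => a * sin (t * b)) /\ Ck1 k (fun t => a * cos (t * b)).
Proof.
have d1 t := is_derive_lamM (is_derive_id t 1) (is_derive_cst b t 1).
have ds a' t : is_derive t 1 (fun t => a' * sin (t * b)) (a' * b * cos (t * b)).
  have d2 := @is_derive_lam_comp R (@sin R) (fun t => t * b) _ _ _ (is_derive_sin (t * b)) (d1 t).
  by apply: (is_derive_eq (is_derive_lamZ a' d2)); rewrite /=; ring.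
have dc a' t : is_derive t 1 (fun t => a' * cos (t * b)) (- a' * b * sin (t * b)).
  have d2 := @is_derive_lam_comp R (@cos R) (fun t => t * b) _ _ _ (is_derive_cos (t * b)) (d1 t).
  by apply: (is_derive_eq (is_derive_lamZ a' d2)); rewrite /=; ring.
have cs a' : continuous (fun t => a' * sin (t * b)).
  by move=> t; exact: is_derive_cont (ds a' t).
have cc a' : continuous (fun t => a' * cos (t * b)).
  by move=> t; exact: is_derive_cont (dc a' t).
elim: k a => [|k IH] a; first by split; split.
split; split => //.
  by exists (fun t => a * b * cos (t * b)); split => //; have [] := IH (a * b).
by exists (fun t => - a * b * sin (t * b)); split => //; have [] := IH (- a * b).
Qed.

(** Truncated powers: [posX m.+1] has [m] continuous derivatives. This yields cutoffs of finite
    order, and four orders are all that the inequality asks for. *)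
Definition posX m t := Num.max 0 t ^+ m.

Lemma continuous_posX m : continuous (posX m).
Proof.
move=> t; apply: (@continuous_comp _ _ _ (fun t => Num.max 0 t) (fun s => s ^+ m)).
  by apply: (@continuous_max _ _ (fun=> 0) id); [exact: cvg_cst|exact: cvg_id].
exact: exprn_continuous.
Qed.

Lemma is_derive_posX m t : is_derive t 1 (posX m.+2) (m.+2%:R * posX m.+1 t).
Proof.
have [t0|t0|->] := ltgtP t 0.
- rewrite /posX max_l ?ltW// expr0n/= mulr0.
  apply: (@near_eq_is_derive _ _ _ (cst (0 : R))).
  near=> s; rewrite max_l ?expr0n//; apply: ltW; near: s; exact: lt_nbhsl.
- rewrite /posX max_r ?ltW//.
  apply: (@near_eq_is_derive _ _ _ (fun s : R => s ^+ m.+2)).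
    near=> s; rewrite max_r//; apply: ltW; near: s; exact: lt_nbhsr.
  apply: (is_derive_eq (is_derive_lamX m.+1 (is_derive_id t 1))).
  by rewrite mulr1.
(* At [0] the difference quotient of [posX m.+2] is [posX m.+1] itself. *)
- apply/is_derive1_caratheodory; exists (posX m.+1); split.
  + move=> z; rewrite /posX maxxx expr0n/= !subr0 -[RHS]mulrC.
    rewrite [in LHS]exprS exprS !mulrA; congr (_ * _).
    by have [z0|z0] := leP z 0; rewrite ?max_l ?max_r ?mulr0 ?mul0r// ltW.
  + exact: continuous_posX.
  + by rewrite /posX maxxx expr0n/= mulr0.
Unshelve. all: end_near. Qed.

Lemma Ck1_posX k (c : R) : Ck1 k (fun t => c * posX k.+1 t).
Proof.
elim: k c => [|k IH] c.
  by split => // t; apply: cvgM; [exact: cvg_cst|exact: continuous_posX].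
have d t : is_derive t 1 (fun t => c * posX k.+2 t) (c * k.+2%:R * posX k.+1 t).
  by apply: (is_derive_eq (is_derive_lamZ c (is_derive_posX k t))); rewrite mulrA.
split; first by move=> t; exact: is_derive_cont (d t).
by exists (fun t => c * k.+2%:R * posX k.+1 t); split.
Qed.

Lemma posX_ge0 m t : 0 <= posX m t.
Proof. by rewrite exprn_ge0// le_max lexx. Qed.

Lemma posX_le1 m t : t <= 1 -> posX m t <= 1.
Proof. by move=> t1; rewrite exprn_ile1 ?le_max ?lexx// ge_max ler01. Qed.

Lemma normr_sin_le t : `|sin t| <= `|t|.
Proof.
have key (s : R) : 0 <= s -> sin s <= s /\ - s <= sin s.
  move=> s0.
  have d1 (x : R) := is_derive_lamB (is_derive_id x 1) (is_derive_sin x).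
  have d2 (x : R) := is_derive_lamD (is_derive_id x 1) (is_derive_sin x).
  pose f1 (x : R) := x - sin x; pose f2 (x : R) := x + sin x.
  have m1 : f1 0 <= f1 s.
    apply: (ger0_derive1_ndecr (a := 0) (b := s) _ _ _ (lexx _) s0 (lexx _)).
    - by move=> x _; have [] := d1 x.
    - move=> x _; rewrite derive1E; have ? := d1 x; rewrite derive_val.
      by rewrite subr_ge0 cos_le1.
    - by apply: derivable_within_continuous => x _; have [] := d1 x.
  have m2 : f2 0 <= f2 s.
    apply: (ger0_derive1_ndecr (a := 0) (b := s) _ _ _ (lexx _) s0 (lexx _)).
    - by move=> x _; have [] := d2 x.
    - move=> x _; rewrite derive1E; have ? := d2 x; rewrite derive_val.
      by have := cos_geN1 x; lra.
    - by apply: derivable_within_continuous => x _; have [] := d2 x.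
  by move: m1 m2; rewrite /f1 /f2 sin0 subr0 addr0; lra.
have [t0|t0] := leP 0 t.
  by have [h1 h2] := key _ t0; rewrite (ger0_norm t0) ler_norml h1 h2.
have [h1 h2] : sin (- t) <= - t /\ - - t <= sin (- t) by apply: key; lra.
by move: h1 h2; rewrite sinN (ltr0_norm t0) ler_norml => h1 h2; apply/andP; split; lra.
Qed.

(** The Caratheodory slope [g] of the sine at [0] satisfies [sin s = g s * s] and [g 0 = 1]; this
    covers [y = 0] too. *)
Lemma sin_scale_cvg (y : R) : (n.+1%:R * sin (y / n.+1%:R)) @[n --> \oo] --> y.
Proof.
have /is_derive1_caratheodory[g [gE cg g0]] := is_derive_sin (0 : R).
rewrite (_ : (fun _ => _) = fun n : nat => y * g (y * harmonic n)); last first.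
  apply/funext => n; have := gE (y / n.+1%:R); rewrite sin0 !subr0 => ->.
  have : n.+1%:R != 0 :> R by rewrite pnatr_eq0.
  by rewrite /harmonic/=; move: (n.+1%:R) => N N0; field.
have h : (y * harmonic n) @[n --> \oo] --> (0 : R).
  by rewrite -[X in _ --> X](mulr0 y); apply: cvgMr; exact: cvg_harmonic.
rewrite -[X in _ --> X](mulr1 y) -cos0 -g0; apply: cvgMr.
exact: (cvg_comp (fun n => y * harmonic n) g h cg).
Qed.

End Ck1_examples.

(** * The cutoff *)

Section cutoff.
Context {R : realType} {n : nat}.
Implicit Types (x : 'rV[R]_n) (rho : R).

(** The exponent [5] gives four continuous derivatives. The Euclidean square is differentiable,
    unlike the sup norm whose balls measure the support. *)
Definition cutoff rho x := posX 5 (1 - sqnorm x / rho ^+ 2).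

Lemma sqnorm_ge0 x : 0 <= sqnorm x.
Proof. by apply: sumr_ge0 => i _; rewrite -expr2 sqr_ge0. Qed.

Lemma coord_le_sqnorm x i : x ord0 i ^+ 2 <= sqnorm x.
Proof.
rewrite /sqnorm (bigD1 i)//= -expr2 lerDl.
by apply: sumr_ge0 => j _; rewrite -expr2 sqr_ge0.
Qed.

Lemma mx_norm_le x rho : 0 <= rho -> (forall i, `|x ord0 i| <= rho) -> `|x| <= rho.
Proof.
move=> r0 xr; have -> : `|x| = mx_norm x by [].
rewrite mx_normrE.
by apply: bigmax_le => // -[i j] _ /=; rewrite (ord1 i).
Qed.

Lemma cutoff_out rho x : 0 < rho -> rho < `|x| -> cutoff rho x = 0.
Proof.
move=> r0 rx.
have [i xi] : exists i, rho < `|x ord0 i|.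
  apply/not_existsP => h; move: rx; rewrite ltNge => /negP; apply.
  by apply: mx_norm_le => [|i]; [exact: ltW|rewrite leNgt; apply/negP; exact: h].
rewrite /cutoff /posX max_l ?expr0n// subr_le0 ler_pdivlMr ?exprn_gt0// mul1r.
apply: le_trans (coord_le_sqnorm x i).
by rewrite -[x ord0 i ^+ 2]real_normK ?num_real// lerXn2r ?nnegrE// ltW.
Qed.

Lemma cutoff_ge0 rho x : 0 <= cutoff rho x.
Proof. exact: posX_ge0. Qed.

Lemma cutoff_le1 rho x : 0 < rho -> cutoff rho x <= 1.
Proof.
move=> r0; apply: posX_le1.
by rewrite gerBl divr_ge0 ?sqnorm_ge0// ltW// exprn_gt0.
Qed.

Lemma Ck_cutoff rho : Ck 4 (cutoff rho).
Proof.
have -> : cutoff rho = (fun t => 1 * posX 5 t) \o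
    (fun x => 1 + - (rho ^+ 2)^-1 * sqnorm x).
  by apply/funext => x; rewrite /cutoff/= mul1r mulNr [_^-1 * _]mulrC.
apply: Ck_comp; first exact: Ck1_posX.
apply: CkD; first exact: Ck_cst.
apply: CkM; first exact: Ck_cst.
by apply: Ck_sum => i; apply: CkM; exact: Ck_coord.
Qed.

(** The [10] is the exponent [5] times the [2] from the square; [|x_i| <= rho] wherever the
    remaining power [posX 4] is nonzero. *)
Lemma partial_cutoff_le rho x i : 0 < rho -> `|partial i (cutoff rho) x| <= 10 / rho.
Proof.
move=> r0.
have d := is_derive_sqnorm i x.
have dS : is_derive x (delta_mx ord0 i) (fun x => 1 - sqnorm x / rho ^+ 2)
    (- (2 * x ord0 i / rho ^+ 2)).
  have d2 := is_deriveD (is_derive_cst (1 : R) x (delta_mx ord0 i))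
    (is_deriveZ (- (rho ^+ 2)^-1) d).
  rewrite (_ : (fun x => _) = cst (1 : R) + - (rho ^+ 2)^-1 *: @sqnorm R n).
    by apply: (is_derive_eq d2); rewrite /GRing.scale/= add0r mulNr mulrC.
  by apply/funext => y; rewrite !fctE /GRing.scale/= mulNr [_^-1 * _]mulrC.
have [df dE] := dS.
have := is_derive_compl (is_derive_posX 3 (1 - sqnorm x / rho ^+ 2)) df.
rewrite dE => dd; rewrite /partial.
rewrite (_ : 'D_(delta_mx ord0 i) (cutoff rho) x =
  5%:R * posX 4 (1 - sqnorm x / rho ^+ 2) * - (2 * x ord0 i / rho ^+ 2)); last first.
  by rewrite -(@derive_val _ _ _ _ _ _ _ dd).
have rr : 0 < rho ^+ 2 by rewrite exprn_gt0.
have [Sr|Sr] := leP (rho ^+ 2) (sqnorm x).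
  rewrite /posX max_l; first by rewrite expr0n/= mulr0 mul0r normr0 divr_ge0// ltW.
  by rewrite subr_le0 ler_pdivlMr// mul1r.
have xr : `|x ord0 i| <= rho.
  rewrite -(@ler_pXn2r _ 2) ?nnegrE ?(ltW r0)// real_normK ?num_real//.
  exact: le_trans (coord_le_sqnorm x i) (ltW Sr).
set p := posX _ _; have p0 : 0 <= p by exact: posX_ge0.
have p1 : p <= 1.
  by apply: posX_le1; rewrite gerBl divr_ge0 ?sqnorm_ge0// ltW.
rewrite normrM normrN normrM (ger0_norm p0) !normrM normfV (gtr0_norm rr).
rewrite !normr_nat.
have -> : 10 / rho = 5 * 1 * (2 * rho / rho ^+ 2) by field; rewrite gt_eqF.
apply: ler_pM.
- by rewrite mulr_ge0.
- by apply: divr_ge0; [rewrite mulr_ge0|exact: ltW].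
- by rewrite ler_pM.
- by rewrite ler_pM2r ?invr_gt0// ler_pM2l.
Qed.

End cutoff.

(** * The approximant for fixed parameters *)

Section approximation.
Context {R : realType} {n : nat}.
Variable f : 'rV[R]_n -> R.
Hypothesis Cf : Ck 4 f.
Variables eps L rho : R.
Hypotheses (eps0 : 0 < eps) (eps1 : eps < 1) (L0 : 0 < L) (rho0 : 0 < rho).
(** [10 * L / rho] bounds what the cutoff adds to each partial derivative. The [n] squares stay
    below [eps ^+ 2], which leaves [eps] after the division by [eps] in [sqgrad_approximant_le]. *)
Hypothesis Lrho : n%:R * (10 * L / rho) ^+ 2 <= eps ^+ 2.

(** [L * sin (f / L)] is bounded by both [L] and [|f|], and its gradient is that of [f] times a
    cosine, hence no longer. The factor [1 - eps] makes room for the gradient of the cutoff. *)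
Definition approximant (x : 'rV[R]_n) := (1 - eps) * (cutoff rho x * (L * sin (f x / L))).

Let Csin : Ck 4 (fun x => L * sin (f x / L)).
Proof.
have [C1 _] := Ck1_sin_cos 4 L L^-1.
exact: (Ck_comp C1 Cf).
Qed.

Lemma Ck_approximant : Ck 4 approximant.
Proof.
apply: CkM; first exact: Ck_cst.
by apply: CkM; first exact: Ck_cutoff.
Qed.

Lemma approximant_out x : rho < `|x| -> approximant x = 0.
Proof. by move=> rx; rewrite /approximant cutoff_out// mul0r mulr0. Qed.

Let e1 : 0 <= 1 - eps <= 1. Proof. by rewrite subr_ge0 ltW//= gerBl ltW. Qed.

Lemma approximant_le_abs x : `|approximant x| <= `|L * sin (f x / L)|.
Proof.
have /andP[e10 e11] := e1.
rewrite /approximant (normrM (1 - eps)) (normrM (cutoff rho x)) (ger0_norm e10).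
rewrite (ger0_norm (cutoff_ge0 _ _)).
rewrite -[leRHS]mul1r; apply: ler_pM => //.
  by apply: mulr_ge0 => //; exact: cutoff_ge0.
rewrite -[leRHS]mul1r; apply: ler_pM => //; first exact: cutoff_ge0.
exact: cutoff_le1.
Qed.

Lemma approximant_leL x : `|approximant x| <= L.
Proof.
apply: (le_trans (approximant_le_abs x)); rewrite normrM (gtr0_norm L0).
by rewrite ler_piMr ?(ltW L0)// ler_norml sin_geN1 sin_le1.
Qed.

Lemma approximant_lef x : `|approximant x| <= `|f x|.
Proof.
apply: (le_trans (approximant_le_abs x)); rewrite normrM (gtr0_norm L0).
rewrite mulrC -ler_pdivlMr//; apply: (le_trans (normr_sin_le _)).
by rewrite normrM normfV (gtr0_norm L0).
Qed.

Lemma partial_approximant i x : exists2 w, `|w| <= 10 * L / rho &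
  partial i approximant x = (1 - eps) * (cutoff rho x * cos (f x / L) * partial i f x) + w.
Proof.
have /andP[e10 e11] := e1.
have [_ /(_ i)[dC _]] := Ck_cutoff (n := n) rho.
have [_ /(_ i)[dS _]] := Csin.
have [_ /(_ i)[df _]] := Cf.
exists ((1 - eps) * (L * sin (f x / L) * partial i (cutoff rho) x)).
  rewrite normrM (ger0_norm e10) (_ : 10 * L / rho = 1 * (L * (10 / rho))); last by ring.
  apply: ler_pM => //; rewrite normrM; apply: ler_pM => //.
    by rewrite normrM (gtr0_norm L0) ler_piMr ?(ltW L0)// ler_norml sin_geN1 sin_le1.
  exact: partial_cutoff_le.
have -> : partial i approximant x =
    (1 - eps) * partial i (fun x => cutoff rho x * (L * sin (f x / L))) x.
  rewrite /partial deriveZ//; exact: derivableM.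
rewrite partialM// -mulrDr; congr (_ * (_ + _)).
rewrite -mulrA; congr (_ * _).
have ds : is_derive (f x) 1 (fun t => L * sin (t / L)) (cos (f x / L)).
  have d1 := is_derive_lamM (is_derive_id (f x) 1) (is_derive_cst L^-1 (f x) 1).
  have d2 := @is_derive_lam_comp R (@sin R) (fun t => t / L) _ _ _ (is_derive_sin (f x / L)) d1.
  apply: (is_derive_eq (is_derive_lamZ L d2)).
  by rewrite /= mulr0 addr0 mul1r mulrCA mulfV ?mulr1// gt_eqF.
exact: (@partial_comp _ _ (fun t => L * sin (t / L)) (fun t => cos (t / L)) f i x ds (df x)).
Qed.

Lemma sqgrad_approximant_le x : sqgrad approximant x <= (1 - eps) * sqgrad f x + eps.
Proof.
have key i : partial i approximant x ^+ 2 <=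
    (1 - eps) * partial i f x ^+ 2 + (10 * L / rho) ^+ 2 / eps.
  have [w wL ->] := partial_approximant i x.
  set a := cutoff rho x * _; set u := partial i f x.
  have a1 : a ^+ 2 <= 1.
    have : `|a| <= 1.
      rewrite normrM (ger0_norm (cutoff_ge0 _ _)) -[leRHS]mul1r.
      by apply: ler_pM; rewrite ?cutoff_ge0 ?cutoff_le1// ler_norml cos_geN1 cos_le1.
    by move=> a1; rewrite -[a ^+ 2]real_normK ?num_real// exprn_ile1.
  have w1 : w ^+ 2 <= (10 * L / rho) ^+ 2.
    rewrite -[w ^+ 2]real_normK ?num_real// lerXn2r ?nnegrE//.
    exact: le_trans wL.
  (* Convexity of the square with weights [1 - eps] and [eps] at the points [a * u] and
     [w / eps]. *)
  apply: (@le_trans _ _ ((1 - eps) * (a * u) ^+ 2 + w ^+ 2 / eps)).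
    rewrite -subr_ge0.
    have -> : (1 - eps) * (a * u) ^+ 2 + w ^+ 2 / eps - ((1 - eps) * (a * u) + w) ^+ 2 =
      (1 - eps) / eps * (eps * (a * u) - w) ^+ 2 by field; rewrite gt_eqF.
    apply: mulr_ge0; last exact: sqr_ge0.
    by apply: divr_ge0; [rewrite subr_ge0|]; exact: ltW.
  apply: lerD.
    rewrite ler_wpM2l ?subr_ge0 ?(ltW eps1)// exprMn -[leRHS]mul1r ler_wpM2r//.
    exact: sqr_ge0.
  by rewrite ler_wpM2r// invr_ge0 ltW.
apply: (le_trans (ler_sum _ (fun i _ => key i))).
rewrite big_split/= -mulr_sumr lerD2l sumr_const card_ord -[_ *+ n]mulr_natl mulrA.
by rewrite ler_pdivrMr// -expr2.
Qed.

(** The gradient bound is a mean of [sqgrad f x] and [1]. If [sqgrad f x >= 1] nothing is lost;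
    otherwise the mean is at most [1], and [Phi_half] gives [14 = 8 + 6], where [8] bounds the
    right-hand [Phi] from below. *)
Lemma Phi_approximant_le x : Phi (sqgrad approximant x / 2) <= Phi (sqgrad f x / 2) + 6.
Proof.
have s0 g : 0 <= sqgrad g x by apply: sumr_ge0 => i _; exact: sqr_ge0.
have sa := s0 approximant; have sf := s0 f; have key := sqgrad_approximant_le x.
have [f1|f1] := leP 1 (sqgrad f x).
  apply: (@le_trans _ _ (Phi (sqgrad f x / 2))); last by rewrite lerDl.
  apply: ler_Phi; first by rewrite divr_ge0.
  rewrite ler_pM2r ?invr_gt0//; apply: (le_trans key); rewrite -subr_ge0.
  rewrite (_ : _ - _ = eps * (sqgrad f x - 1)); last by ring.
  by rewrite mulr_ge0 ?(ltW eps0)// subr_ge0.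
have : Phi (sqgrad approximant x / 2) <= Phi 2^-1.
  apply: ler_Phi; first by rewrite divr_ge0.
  rewrite -[leRHS]mul1r ler_pM2r ?invr_gt0//; apply: (le_trans key).
  rewrite -subr_ge0 (_ : _ - _ = (1 - eps) * (1 - sqgrad f x)); last by ring.
  by rewrite mulr_ge0// subr_ge0 ltW.
move=> h; apply: (le_trans h); apply: (le_trans Phi_half).
have : 8 <= Phi (sqgrad f x / 2) by apply: Phi_ge8; rewrite divr_ge0.
by move: (Phi _) => p p8; lra.
Qed.

(** Far away the exponential is [1], so compact support holds only after subtracting [1]. *)
Lemma bsmooth_expR_approximant : bsmooth 4 (fun x => expR (approximant x)).
Proof.
have b1 : bsmooth 4 (fun x => expR (approximant x) + (- 1)).
  apply: (@Ck_bsmooth _ _ _ rho); first by move=> x rx; rewrite approximant_out// expR0 subrr.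
  apply: CkD; last exact: Ck_cst.
  exact: (Ck_comp (Ck1_expR 4) Ck_approximant).
have -> : (fun x => expR (approximant x)) = fun x => (expR (approximant x) + (- 1)) + 1.
  by apply/funext => x; rewrite subrK.
by apply: bsmoothD b1 _; exact: bsmooth_cst.
Qed.

Lemma logfun_expR_approximant x :
  logfun (fun x => expR (approximant x)) x = approximant x + Phi (sqgrad approximant x / 2).
Proof.
rewrite /logfun expRK; congr (_ + Phi _).
have [_ da] := Ck_approximant.
rewrite /sqgrad (eq_bigr (fun i =>
    expR (approximant x) ^+ 2 * partial i approximant x ^+ 2)); last first.
  move=> i _; rewrite -exprMn; congr (_ ^+ 2).
  have [dai _] := da i.
  exact: (@partial_comp _ _ (@expR R) (@expR R) approximant i x (is_derive_expR _) (dai x)).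
rewrite -mulr_sumr; set S := \sum_(i < n) _.
by field; rewrite gt_eqF// expR_gt0.
Qed.

Lemma approximant_functional :
  ln (\int[gaussian R n]_x expR (approximant x)) + 8 <=
  \int[gaussian R n]_x (approximant x + Phi (sqgrad approximant x / 2)).
Proof.
have c0 : 0 < expR (- L) by exact: expR_gt0.
apply: (le_trans (gaussian_functional c0 _ bsmooth_expR_approximant)).
  by move=> x; rewrite ler_expR; have := approximant_leL x; rewrite ler_norml => /andP[].
rewrite le_eqVlt; apply/predU1P; left; apply: eq_Rintegral => x _.
exact: logfun_expR_approximant.
Qed.

End approximation.

(** * Passage to the limit *)

Section limits.
Context {R : realType}.

(** The integral is a difference of nonnegative parts. As [+oo - +oo] is [-oo] in [\bar R], an
    infinite part never gives [0]; so the mean-zero hypothesis contains integrability. *)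
Lemma integrable_of_integral0 d (T : measurableType d) (mu : {measure set T -> \bar R})
    (f : T -> \bar R) : measurable_fun setT f ->
  (\int[mu]_x f x = 0)%E -> mu.-integrable setT f.
Proof.
move=> mf; rewrite integralE.
set p := (\int[mu]_x (f^\+ x))%E; set m := (\int[mu]_x (f^\- x))%E => pm.
have p0 : (0 <= p)%E by apply: integral_ge0.
have m0 : (0 <= m)%E by apply: integral_ge0.
have [pf mf'] : (p < +oo /\ m < +oo)%E.
  by move: p m p0 m0 pm => [p| |] [m| |]//= _ _ _; rewrite !ltry.
rewrite (funeposneg f); apply: integrableB => //; apply/integrableP; split.
- exact: measurable_funepos.
- by under eq_integral do rewrite gee0_abs//.
- exact: measurable_funeneg.
- by under eq_integral do rewrite gee0_abs//.
Qed.

Lemma limn_einf_le (u : (\bar R)^nat) (c : \bar R) :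
  (\forall n \near \oo, u n <= c)%E -> (limn_einf u <= c)%E.
Proof.
move=> uc; rewrite limn_einf_lim; apply: lime_le; first exact: is_cvg_einfs.
near=> n; apply: (@le_trans _ _ (u n)); last by near: n.
by apply: ereal_inf_lbound; exists n => /=.
Unshelve. all: end_near. Qed.

End limits.

Section main.
Context {R : realType} {n : nat}.
Variable f : 'rV[R]_n -> R.
Hypothesis Cf : forall k, Ck k f.
Local Notation G := (gaussian R n).

(** [j.+2] keeps [eps] strictly below [1]. The choice of [rho] makes [10 * L / rho] equal to
    [eps / n.+1], and [n <= n.+1 ^ 2] gives [Lrho]. *)
Let eps (j : nat) : R := j.+2%:R^-1.
Let L (j : nat) : R := j.+1%:R.
Let rho (j : nat) : R := 10 * n.+1%:R * j.+1%:R * j.+2%:R.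
Let F j := approximant f (eps j) (L j) (rho j).

Let eps0 j : 0 < eps j. Proof. by rewrite invr_gt0 ltr0n. Qed.
Let eps1 j : eps j < 1. Proof. by rewrite invf_lt1 ?ltr0n// ltr1n. Qed.
Let L0 j : 0 < L j. Proof. by rewrite ltr0n. Qed.
Let rho0 j : 0 < rho j. Proof. by rewrite !mulr_gt0 ?ltr0n. Qed.

Let Lrho j : n%:R * (10 * L j / rho j) ^+ 2 <= eps j ^+ 2.
Proof.
have -> : 10 * L j / rho j = n.+1%:R^-1 * eps j.
  rewrite /L /rho /eps.
  have : n.+1%:R != 0 :> R by rewrite pnatr_eq0.
  have : j.+1%:R != 0 :> R by rewrite pnatr_eq0.
  have : j.+2%:R != 0 :> R by rewrite pnatr_eq0.
  move: (n.+1%:R) (j.+1%:R) (j.+2%:R) => a b c c0 b0 a0; field.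
  by rewrite a0 b0 c0.
rewrite exprMn mulrA ler_piMl ?sqr_ge0// exprVn ler_pdivrMr ?exprn_gt0 ?ltr0n//.
by rewrite mul1r -natrX ler_nat (leq_trans (leqnSn n))// -{1}[n.+1]expn1 leq_pexp2l.
Qed.

Let cont_f : continuous f. Proof. exact: Ck_cont (Cf 0). Qed.

Let cont_partial i : continuous (partial i f).
Proof. by have [_ /(_ i)[_ []]] := Cf 1. Qed.

Let mf : measurable_fun setT (f : borel_rV R n -> R).
Proof. exact: continuous_rV_measurable. Qed.

Lemma measurable_sqgrad : measurable_fun setT (sqgrad f : borel_rV R n -> R).
Proof.
apply: measurable_sum => i; apply: measurable_funX.
exact: continuous_rV_measurable.
Qed.

Lemma sqgrad_ge0 x : 0 <= sqgrad f x.
Proof. by apply: sumr_ge0 => i _; exact: sqr_ge0. Qed.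

Lemma measurable_Phi_sqgrad :
  measurable_fun setT (fun x : borel_rV R n => Phi (sqgrad f x / 2)).
Proof.
by apply: measurable_fun_Phi; apply: measurable_funM => //; exact: measurable_sqgrad.
Qed.

Lemma cutoff_cvg (x : 'rV[R]_n) : cutoff (rho j) x @[j --> \oo] --> (1 : R).
Proof.
have h : (1 - sqnorm x / rho j ^+ 2) @[j --> \oo] --> (1 : R).
  rewrite -[X in _ --> X]subr0; apply: cvgB; first exact: cvg_cst.
  have hx : (sqnorm x * harmonic j) @[j --> \oo] --> (0 : R).
    by rewrite -[X in _ --> X](mulr0 (sqnorm x)); apply: cvgMr; exact: cvg_harmonic.
  apply: (squeeze_cvgr _ (cvg_cst 0) hx); apply: nearW => j.
  rewrite divr_ge0 ?sqnorm_ge0 ?sqr_ge0//= ler_wpM2l ?sqnorm_ge0//.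
  rewrite lef_pV2 ?posrE ?ltr0n ?exprn_gt0//.
  rewrite /rho -!natrM -natrX ler_nat; nia.
have p1 : posX 5 (1 : R) = 1 by rewrite /posX max_r// expr1n.
rewrite -[X in _ --> X]p1.
exact: (cvg_comp (fun j => 1 - sqnorm x / rho j ^+ 2) (posX 5) h (@continuous_posX R 5 1)).
Qed.

Lemma approximant_cvg (x : 'rV[R]_n) : F j x @[j --> \oo] --> f x.
Proof.
have h1 : (1 - eps j) @[j --> \oo] --> (1 : R).
  rewrite -[X in _ --> X]subr0; apply: cvgB; first exact: cvg_cst.
  apply: (squeeze_cvgr _ (cvg_cst 0) (@cvg_harmonic R)); apply: nearW => j.
  by rewrite (ltW (eps0 j))/= lef_pV2 ?posrE ?ltr0n// ler_nat.
have := cvgM h1 (cvgM (@cutoff_cvg x) (@sin_scale_cvg R (f x))).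
by rewrite !mul1r; exact.
Qed.

Hypothesis f0 : (\int[G]_x (f x)%:E = 0)%E.

Let intf : G.-integrable setT (EFin \o (f : borel_rV R n -> R)).
Proof. by apply: integrable_of_integral0 => //; exact/measurable_EFinP. Qed.

Let bmfun_F j : bmfun (F j : borel_rV R n -> R).
Proof.
split; last by exists (L j) => x; exact: approximant_leL.
by apply: continuous_rV_measurable; exact: (Ck_cont (Ck_approximant (Cf 4) (eps j) (L j) (rho j))).
Qed.

(** Dominated convergence, with [|F j| <= |f|]. *)
Lemma integral_approximant_cvg : (\int[G]_x F j x) @[j --> \oo] --> (0 : R).
Proof.
have h : (\int[G]_x (F j x)%:E)%E @[j --> \oo] --> (\int[G]_x (f x)%:E)%E.
  apply: (@dominated_cvg _ _ _ G setT measurableT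
    (fun j (x : borel_rV R n) => (F j x)%:E) _ (abse \o (EFin \o f))).
  - by move=> j; apply/measurable_EFinP; have [] := bmfun_F j.
  - by move=> x _; apply: cvg_EFin; [exact: nearW|exact: approximant_cvg].
  - by [].
  - exact: (integrable_abse intf).
  - by move=> j x _ /=; rewrite lee_fin; exact: approximant_lef.
by move: h; rewrite f0 => /fine_cvg.
Qed.

(** The [- 2] is the loss [6] of [Phi_approximant_le] minus the slack [8] of
    [gaussian_functional]. *)
Lemma ln_integral_approximant_le A j :
  (\int[G]_x (Phi (sqgrad f x / 2))%:E = A%:E)%E ->
  ln (\int[G]_x expR (F j x)) <= \int[G]_x F j x + A - 2.
Proof.
move=> IA.
have mP := measurable_Phi_sqgrad.
have P0 x : 0 <= Phi (sqgrad f x / 2).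
  by rewrite (le_trans _ (Phi_ge8 _))// divr_ge0// sqgrad_ge0.
have iP : G.-integrable setT (EFin \o (fun x : borel_rV R n => Phi (sqgrad f x / 2))).
  apply/integrableP; split; first exact/measurable_EFinP.
  by under eq_integral do rewrite /= ger0_norm//; rewrite IA ltry.
have iF : G.-integrable setT (EFin \o (F j : borel_rV R n -> R)).
  exact: bmfun_integrable.
have i6 : G.-integrable setT (EFin \o (cst 6 : borel_rV R n -> R)).
  by apply: bmfun_integrable; exact: bmfun_cst.
have iP6 : G.-integrable setT
    (EFin \o (fun x : borel_rV R n => Phi (sqgrad f x / 2) + 6)).
  by rewrite /comp; under eq_fun do rewrite EFinD; exact: (integrableD measurableT iP i6).
have := approximant_functional (Cf 4) (eps0 j) (eps1 j) (L0 j) (rho0 j).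
set I1 := \int[G]_x (_ + _) => h.
have : I1 <= \int[G]_x (F j x + (Phi (sqgrad f x / 2) + 6)).
  apply: le_Rintegral => //.
  - have bl : bmfun (logfun (fun x => expR (F j x)) : borel_rV R n -> R).
      apply: (@bmfun_logfun _ _ _ (expR (- L j))); first exact: expR_gt0.
        move=> x; rewrite ler_expR.
        have := approximant_leL f (eps0 j) (eps1 j) (L0 j) (rho0 j) x.
        by rewrite ler_norml => /andP[].
      by do 3!apply: bsmoothW; exact: (bsmooth_expR_approximant (Cf 4) _ _ (rho0 j)).
    move: bl; rewrite (_ : logfun _ = fun x => F j x + Phi (sqgrad (F j) x / 2)).
      exact: bmfun_integrable.
    by apply/funext => x; exact: (logfun_expR_approximant (Cf 4)).
  - by rewrite /comp; under eq_fun do rewrite EFinD; exact: (integrableD measurableT iF iP6).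
  - move=> x _; rewrite lerD2l; apply: Phi_approximant_le => //; exact: Lrho.
rewrite RintegralD// (RintegralD measurableT iP i6) Rintegral_cst//= probability_setT mulr1.
rewrite [X in _ <= _ + (X + _)](_ : _ = A); last by rewrite /Rintegral IA.
move: h; rewrite -/(F j); lra.
Qed.

(** Integrability of [expR (f x)] is part of the conclusion, so Fatou's lemma is used instead of
    domination; it asks only for bounds on the integrals for large [j]. *)
Lemma log_laplace_le A : (\int[G]_x (Phi (sqgrad f x / 2))%:E = A%:E)%E ->
  (\int[G]_x (expR (f x))%:E <= (expR A)%:E)%E.
Proof.
move=> IA.
have bE j : bmfun (fun x : borel_rV R n => expR (F j x)).
  exact: (bsmooth_bmfun (bsmooth_expR_approximant (Cf 4) _ _ (rho0 j))).
have -> : (\int[G]_x (expR (f x))%:E =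
    \int[G]_x (limn_einf (fun j => (expR (F j x))%:E)))%E.
  apply: eq_integral => x _; apply/esym.
  have h : (expR (F j x))%:E @[j --> \oo] --> (expR (f x))%:E.
    apply: cvg_EFin; first exact: nearW.
    exact: (cvg_comp (fun j => F j x) (@expR R) (@approximant_cvg x) (@continuous_expR R (f x))).
  rewrite is_cvg_limn_einfE; first exact/cvg_lim.
  by apply/cvg_ex; eexists; exact: h.
have mE j : measurable_fun setT (fun x : borel_rV R n => (expR (F j x))%:E).
  by apply/measurable_EFinP; have [] := bE j.
have E0 j (x : borel_rV R n) : setT x -> (0 <= (expR (F j x))%:E)%E.
  by move=> _; rewrite lee_fin expR_ge0.
apply: (le_trans (fatou G measurableT mE E0)).
apply: limn_einf_le; near=> j.
have -> : (\int[G]_x (expR (F j x))%:E = (\int[G]_x expR (F j x))%:E)%E.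
  by rewrite /Rintegral fineK//; apply: integrable_fin_num => //; exact: bmfun_integrable.
rewrite lee_fin.
have [I0|I0] := leP (\int[G]_x expR (F j x)) 0; first exact: le_trans I0 (expR_ge0 _).
rewrite -[leLHS]lnK ?posrE// ler_expR (le_trans (ln_integral_approximant_le j IA))//.
(* The means tend to [0], so they eventually fall below the remaining slack [2]. *)
have : \int[G]_x F j x < 2 by near: j; exact: (cvgr_lt _ integral_approximant_cvg).
by move: (\int[G]_x F j x) => i i2; lra.
Unshelve. all: end_near. Qed.

End main.

Theorem corollary4p2 (R : realType) (n : nat) (n_ge1 : (1 <= n)%N)
    (f : 'rV[R]_n -> R) (f_smooth : smooth f)
    (f_mean0 : (\int[gaussian R n]_x (f x)%:E = 0)%E) :
  (lne (\int[gaussian R n]_x (expR (f x))%:E)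
     <= 8%:E * \int[gaussian R n]_x
          (expR (enorm (gradient f x) ^+ 2 / 2)
             / Num.sqrt (1 + enorm (gradient f x) ^+ 2 / 2))%:E)%E
  /\
  (8%:E * \int[gaussian R n]_x
       (expR (enorm (gradient f x) ^+ 2 / 2)
          / Num.sqrt (1 + enorm (gradient f x) ^+ 2 / 2))%:E
     <= 14%:E * \int[gaussian R n]_x
          (expR (enorm (gradient f x) ^+ 2 / 2)
             / (1 + enorm (gradient f x)))%:E)%E.
Proof.
have Cf k : Ck k f by exact: smooth_Ck.
have gE x : enorm (gradient f x) ^+ 2 = sqgrad f x.
  by rewrite sqr_enorm; apply: eq_bigr => i _; rewrite mxE.
have ms : measurable_fun setT (sqgrad f : borel_rV R n -> R).
  exact: measurable_sqgrad Cf.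
have me : measurable_fun setT (fun x : borel_rV R n => enorm (gradient f x)).
  rewrite (_ : (fun _ => _) = fun x => Num.sqrt (sqgrad f x)); last first.
    by apply/funext => x; rewrite -gE sqrtr_sqr ger0_norm// sqrtr_ge0.
  apply: measurableT_comp ms.
  by apply: continuous_measurable_fun; exact: sqrt_continuous.
have e0 x : 0 <= enorm (gradient f x) by exact: sqrtr_ge0.
have mq : measurable_fun setT (fun x : borel_rV R n => enorm (gradient f x) ^+ 2 / 2).
  by apply: measurable_funM => //; exact: measurable_funX.
have mexp : measurable_fun setT
    (fun x : borel_rV R n => expR (enorm (gradient f x) ^+ 2 / 2)).
  by apply: measurableT_comp mq; exact: measurable_expR.
have q0 x : 0 <= enorm (gradient f x) ^+ 2 / 2 by rewrite divr_ge0 ?sqr_ge0.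
have m1 : measurable_fun setT (fun x : borel_rV R n =>
    expR (enorm (gradient f x) ^+ 2 / 2) / Num.sqrt (1 + enorm (gradient f x) ^+ 2 / 2)).
  apply: measurable_funM mexp _; apply: measurable_fun_invr.
    by move=> x; rewrite sqrtr_gt0 ltr_wpDr.
  apply: (measurableT_comp (f := @Num.sqrt R)).
    by apply: continuous_measurable_fun; exact: sqrt_continuous.
  exact: measurable_funD.
have m2 : measurable_fun setT (fun x : borel_rV R n =>
    expR (enorm (gradient f x) ^+ 2 / 2) / (1 + enorm (gradient f x))).
  apply: measurable_funM mexp _; apply: measurable_fun_invr.
    by move=> x; rewrite ltr_wpDr.
  exact: measurable_funD.
have p1 x : 0 <= expR (enorm (gradient f x) ^+ 2 / 2) /
    Num.sqrt (1 + enorm (gradient f x) ^+ 2 / 2).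
  by rewrite divr_ge0 ?expR_ge0 ?sqrtr_ge0.
have p2 x : 0 <= expR (enorm (gradient f x) ^+ 2 / 2) / (1 + enorm (gradient f x)).
  by rewrite divr_ge0 ?expR_ge0 ?addr_ge0.
split; last first.
  have E1 (x : borel_rV R n) : setT x -> (0 <= (expR (enorm (gradient f x) ^+ 2 / 2) /
      Num.sqrt (1 + enorm (gradient f x) ^+ 2 / 2))%:E)%E by move=> _; rewrite lee_fin.
  have E2 (x : borel_rV R n) : setT x -> (0 <= (expR (enorm (gradient f x) ^+ 2 / 2) /
      (1 + enorm (gradient f x)))%:E)%E by move=> _; rewrite lee_fin.
  rewrite -!ge0_integralZl//; do ?[exact/measurable_EFinP|exact: E1|exact: E2].
  apply: ge0_le_integral => //.
  - by apply/measurable_EFinP; exact: measurable_funM.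
  - by apply/measurable_EFinP; exact: measurable_funM.
  - by move=> x _; rewrite -!EFinM lee_fin; exact: expR_sqrt_le.
rewrite -ge0_integralZl//; do ?[exact/measurable_EFinP|by move=> x _; rewrite lee_fin].
rewrite (eq_integral (fun x : borel_rV R n => (Phi (sqgrad f x / 2))%:E)); last first.
  by move=> x _; rewrite -EFinM -PhiE// gE.
have I0 : (0 <= \int[gaussian R n]_x (Phi (sqgrad f x / 2))%:E)%E.
  apply: integral_ge0 => x _; rewrite lee_fin -gE.
  by rewrite (le_trans _ (Phi_ge8 (q0 x))).
(* For the value [+oo] there is nothing to prove, and [I0] excludes [-oo]. *)
move: I0; case IA : (\int[gaussian R n]_x (Phi (sqgrad f x / 2))%:E)%E => [A| |]// _.
  have := log_laplace_le Cf f_mean0 IA.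
  (* Both sides become values of [lne], which is monotone on the nonnegative extended reals. *)
  have -> : A%:E = lne (expR A)%:E by rewrite lne_EFin ?expR_gt0// expRK.
  have E0 : (0 <= \int[gaussian R n]_x (expR (f x))%:E)%E.
    by apply: integral_ge0 => x _; rewrite lee_fin expR_ge0.
  by rewrite lee_lne//; rewrite in_itv/= leey andbT// lee_fin expR_ge0.
by rewrite leey.
Qed.
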